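(* Let $\mathcal{K} \subseteq \mathbb{R}^n$ be a convex body and let $f \in L^1(\mathrm{M}(n))$ be a bounded real-valued function such that: (i) $f$ is continuous and of positive type; (ii) $f(x, A) \leq 0$ whenever $\mathcal{K}^\circ \cap (x + A\mathcal{K}^\circ) = \emptyset$, where $\mathcal{K}^\circ$ is the interior of $\mathcal{K}$; (iii) $\lambda = \int_{\mathrm{M}(n)} f(x, A)\, d(x, A) > 0$. Then the density of any packing of congruent copies of $\mathcal{K}$ is at most $$\frac{f(0, I)}{\lambda} \operatorname{vol} \mathcal{K},$$ where $\operatorname{vol}\mathcal{K}$ is the volume of $\mathcal{K}$.
   Context: $\mathrm{SO}(n) = \{A \in \mathbb{R}^{n\times n} : A^{\mathsf T}A = I,\ \det A = 1\}$. The Euclidean motion group is the set $\mathrm{M}(n) = \mathbb{R}^n \times \mathrm{SO}(n)$ with identity $(0, I)$, multiplication $(x, A)(y, B) = (x + Ay, AB)$ and inverse $(x, A)^{-1} = (-A^{-1}x, A^{-1})$. Functions on $\mathrm{M}(n)$ are integrated with respect to the measure $d(x, A)$, the product of Lebesgue measure $dx$ on $\mathbb{R}^n$ and the Haar measure $dA$ on $\mathrm{SO}(n)$ normalized so that $\mathrm{SO}(n)$ has total measure $1$. A bounded complex-valued function $f \in L^\infty(\mathrm{M}(n))$ is of positive type if $f(x, A) = \overline{f((x, A)^{-1})}$ for all $(x, A) \in \mathrm{M}(n)$ and, for all $\rho \in L^1(\mathrm{M}(n))$, $$\int_{\mathrm{M}(n)} \int_{\mathrm{M}(n)} f((y, B)^{-1}(x,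 A))\, \rho(x, A)\, \overline{\rho(y, B)}\, d(y, B)\, d(x, A) \geq 0.$$ A congruent copy of $\mathcal{K}$ is a set $x + A\mathcal{K}$ with $(x, A) \in \mathrm{M}(n)$ (i.e. a rotated and translated copy). A packing of congruent copies of $\mathcal{K}$ is a union $\mathcal{P}$ of congruent copies of $\mathcal{K}$ with pairwise disjoint interiors. A packing $\mathcal{P}$ has density $\Delta$ if for all $p \in \mathbb{R}^n$ one has $\Delta = \lim_{r\to\infty} \operatorname{vol}(B(p, r) \cap \mathcal{P})/\operatorname{vol} B(p, r)$, where $B(p, r)$ is the ball of radius $r$ centered at $p$. Not every packing has a density, but every packing has an upper density $$\limsup_{r \to \infty}\ \sup_{p \in \mathbb{R}^n} \frac{\operatorname{vol}(B(p, r) \cap \mathcal{P})}{\operatorname{vol} B(p, r)},$$ and the bound on the density of an arbitrary packing is understood as a bound on its upper density. *)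

(* Defs.v *)
From HB Require Import structures.
From mathcomp Require Import all_boot all_order all_algebra.
From mathcomp Require Import all_classical all_reals all_analysis.
From mathcomp Require Import measurable_realfun complex.

Set Implicit Arguments.
Unset Strict Implicit.
Unset Printing Implicit Defensive.

Import Order.TTheory GRing.Theory Num.Theory.
Import numFieldNormedType.Exports.

Local Open Scope classical_set_scope.
Local Open Scope ring_scope.

(* The sigma-algebra on matrices is the one generated by the entries, as the
   library does for tuples; for real matrices it contains the open sets
   (lemma [measurable_mx_open]), hence is the Borel sigma-algebra. *)
Definition measure_mx_display : measure_display -> measure_display.
Proof. exact. Qed.

Section measurable_matrix.
Context {d} {T : measurableType d}.
Variables m n : nat.

Definition mx_entry (ij : 'I_m * 'I_n) (M : 'M[T]_(m, n)) : T := M ij.1 ij.2.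

Definition mx_entry_sets : set (set 'M[T]_(m, n)) :=
  [set B | exists ij : 'I_m * 'I_n,
     exists2 Y : set T, measurable Y & B = mx_entry ij @^-1` Y].

Let mx_set0 : <<s mx_entry_sets >> set0.
Proof. exact: sigma_algebra0. Qed.

Let mx_setC A : <<s mx_entry_sets >> A -> <<s mx_entry_sets >> (~` A).
Proof. exact: sigma_algebraC. Qed.

Let mx_bigcup (F : (set 'M[T]_(m, n))^nat) :
  (forall i, <<s mx_entry_sets >> (F i)) ->
  <<s mx_entry_sets >> (\bigcup_i (F i)).
Proof. exact: sigma_algebra_bigcup. Qed.

HB.instance Definition _ := @isMeasurable.Build (measure_mx_display d)
  'M[T]_(m, n) <<s mx_entry_sets >> mx_set0 mx_setC mx_bigcup.

Lemma measurable_mx_entry (i : 'I_m) (j : 'I_n) :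
  measurable_fun [set: 'M[T]_(m, n)] (fun M : 'M[T]_(m, n) => M i j).
Proof.
move=> _ Y mY; rewrite setTI; apply: sub_sigma_algebra.
by exists (i, j), Y.
Qed.

Lemma measurable_fun_mxP d' (T' : measurableType d') (f : T' -> 'M[T]_(m, n)) :
  (forall i j, measurable_fun [set: T'] (fun t => f t i j)) ->
  measurable_fun [set: T'] f.
Proof.
move=> mf; apply: measurability => // _ [_ [[i j] [Y mY ->]] <-].
exact: mf.
Qed.

End measurable_matrix.

Lemma measurable_mx_open (R : realType) m n (U : set 'M[R]_(m, n)) :
  open U -> measurable U.
Proof.
move=> oU.
pose box (p : 'M[rat]_(m, n) * nat) : set 'M[R]_(m, n) :=
  [set M | forall i j, `|ratr (p.1 i j) - M i j| < p.2.+1%:R^-1 :> R].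
have mbox p : measurable (box p).
  pose B (ij : 'I_m * 'I_n) : set 'M[R]_(m, n) :=
    (fun M : 'M[R]_(m, n) => M ij.1 ij.2) @^-1`
      ball (ratr (p.1 ij.1 ij.2) : R) p.2.+1%:R^-1.
  have -> : box p = \bigcap_(ij in [set: 'I_m * 'I_n]) B ij.
    by apply/seteqP; split=> [M bM [i j] _|M bM i j]; [exact: bM|exact: (bM (i, j))].
  apply: fin_bigcap_measurable => [|[i j] _]; first exact: finite_finset.
  rewrite /B -[_ @^-1` _]setTI; apply: measurable_mx_entry => //.
  exact: measurable_ball.
rewrite (_ : U = \bigcup_p (if `[< box p `<=` U >] then box p else set0)).
  apply: countable_bigcupT_measurable; first exact: countableP.
  by move=> p; case: ifPn.
apply/seteqP; split=> [M UM|M [p] _]; last first.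
  by case: ifPn => // /asboolP; exact.
have /nbhs_ballP[e /= e0 eU] : nbhs M U by exact: open_nbhs_nbhs.
have [k _ ke] := near_infty_natSinv_lt (PosNum (divr_gt0 e0 (@ltr0n R 2))).
have {}ke : k.+1%:R^-1 < e / 2 by exact: (ke k (leqnn k)).
have k0 : 0 < k.+1%:R^-1 :> R by rewrite invr_gt0.
have /choice[q qM] ij : exists q : rat,
    `|ratr q - M (ij : 'I_m * 'I_n).1 ij.2| < k.+1%:R^-1 :> R.
  have := @rat_in_itvoo R (M ij.1 ij.2 - k.+1%:R^-1) (M ij.1 ij.2).
  rewrite ltrBlDr ltrDl => /(_ k0)[q /itvP qM]; exists q.
  by rewrite ltr_distl qM/= (lt_trans (y := M ij.1 ij.2)) ?qM// ltrDl.
exists (\matrix_(i, j) q (i, j), k) => //; case: ifPn => [_ i j|/asboolP[]].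
  by rewrite /= mxE; exact: (qM (i, j)).
move=> N bN; apply: eU; split => // i j /=.
have := bN i j; have := qM (i, j); rewrite /= mxE => qMij qNij.
suff : `|M i j - N i j| < e by [].
rewrite (splitr e) (le_lt_trans (ler_distD (ratr (q (i, j))) _ _))//.
by rewrite ltrD// (lt_trans _ ke)// distrC.
Qed.

Section lebesgue_Rn.
Variable R : realType.

Definition cv_cons n (p : 'cV[R]_n * measurableTypeR R) : 'cV[R]_n.+1 :=
  col_mx (const_mx p.2 : 'cV[R]_1) p.1.

Lemma measurable_cv_cons n : measurable_fun [set: _] (@cv_cons n).
Proof.
apply: measurable_fun_mxP => i j.
have [k ik|k ik] := splitP (i : 'I_(1 + n)).
  rewrite (_ : (fun p => _) = snd); first exact: measurable_snd.
  apply/funext => p; rewrite /cv_cons (_ : i = lshift n k); last exact: val_inj.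
  by rewrite [LHS](@col_mxEu R 1 n 1) mxE.
rewrite (_ : (fun p => _) = (fun x : 'cV[R]_n => x k j) \o fst).
  by apply: measurableT_comp; [exact: measurable_mx_entry|exact: measurable_fst].
apply/funext => p; rewrite /cv_cons (_ : i = rshift 1 k); last exact: val_inj.
by rewrite [LHS](@col_mxEd R 1 n 1).
Qed.

Section extend.
Variables (n : nat) (m : {measure set 'cV[R]_n -> \bar R}).

Definition lebesgue_cv_extend : set 'cV[R]_n.+1 -> \bar R :=
  pushforward (m \x lebesgue_measure)%E (@cv_cons n).

Let extend0 : lebesgue_cv_extend set0 = 0%E.
Proof. by rewrite /lebesgue_cv_extend /pushforward preimage_set0 measure0. Qed.

Let extend_ge0 A : (0 <= lebesgue_cv_extend A)%E.
Proof. by rewrite /lebesgue_cv_extend /pushforward; exact: measure_ge0. Qed.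

Let extend_sigma_additive : semi_sigma_additive lebesgue_cv_extend.
Proof.
move=> F mF tF mUF; rewrite /lebesgue_cv_extend /pushforward preimage_bigcup.
have mcF A : measurable A -> measurable (@cv_cons n @^-1` A).
  by move=> mA; rewrite -[_ @^-1` _]setTI; exact: measurable_cv_cons.
apply: measure_semi_sigma_additive.
- by move=> k; exact: mcF.
- apply/trivIsetP => /= i j _ _ ij; rewrite -preimage_setI.
  by move/trivIsetP : tF => /(_ _ _ _ _ ij) ->//; rewrite preimage_set0.
- by rewrite -preimage_bigcup; exact: mcF.
Qed.

HB.instance Definition _ := isMeasure.Build _ _ _ lebesgue_cv_extend
  extend0 extend_ge0 extend_sigma_additive.

End extend.

(* Lebesgue measure on R^n, as the n-fold product of the one on R; in
   dimension 0 it is the unit mass at the only point. *)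
Fixpoint lebesgue_cv (n : nat) : {measure set 'cV[R]_n -> \bar R} :=
  match n with
  | 0%N => dirac (0 : 'cV[R]_0)
  | n'.+1 => lebesgue_cv_extend (lebesgue_cv n')
  end.

End lebesgue_Rn.

Section special_orthogonal.
Variables (R : realType) (n : nat).

Definition is_SO (A : 'M[R]_n) : bool := (A^T *m A == 1%:M) && (\det A == 1).

Record SO := MkSO { so_mx :> 'M[R]_n ; so_mxP : is_SO so_mx }.

HB.instance Definition _ := [isSub for so_mx].
HB.instance Definition _ := [Choice of SO by <:].

Lemma is_SO1 : is_SO 1%:M.
Proof. by rewrite /is_SO trmx1 mul1mx det1 !eqxx. Qed.

Lemma is_SOM A B : is_SO A -> is_SO B -> is_SO (A *m B).
Proof.
move=> /andP[/eqP A1 /eqP dA] /andP[/eqP B1 /eqP dB].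
by rewrite /is_SO trmx_mul mulmxA -(mulmxA B^T) A1 mulmx1 B1 det_mulmx dA dB mulr1 !eqxx.
Qed.

Lemma is_SO_inv A : is_SO A -> is_SO (invmx A).
Proof.
move=> /andP[/eqP A1 /eqP dA].
have Au : A \in unitmx by rewrite unitmxE dA unitr1.
have -> : invmx A = A^T by rewrite -[RHS]mulmx1 -(mulmxV Au) mulmxA A1 mul1mx.
by rewrite /is_SO trmxK (mulmx1C A1) det_tr dA !eqxx.
Qed.

Definition so_one : SO := MkSO is_SO1.
Definition so_mul (A B : SO) : SO := MkSO (is_SOM (so_mxP A) (so_mxP B)).
Definition so_inv (A : SO) : SO := MkSO (is_SO_inv (so_mxP A)).

HB.instance Definition _ := isPointed.Build SO so_one.

HB.instance Definition _ := Topological.copy SO (initial_topology so_mx).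

HB.instance Definition _ :=
  Measurable.copy SO (g_sigma_algebra_preimageType so_mx).

Lemma measurable_SO_open (U : set SO) : open U -> measurable U.
Proof.
by move=> [V oV <-]; exists V; [exact: measurable_mx_open|rewrite setTI].
Qed.

(* A left-invariant Borel probability measure on SO(n): as SO(n) is a compact
   group, there is exactly one, the normalized Haar measure. *)
Definition is_haar (haar : probability SO R) : Prop :=
  forall (A : SO) (E : set SO), measurable E ->
    haar [set so_mul A B | B in E] = haar E.

End special_orthogonal.

Notation motion R n := ('cV[R]_n * SO R n)%type.

Section motion_group.
Variables (R : realType) (n : nat).
Implicit Types (z w : motion R n) (S : set 'cV[R]_n).

Definition mot_one : motion R n := (0, so_one R n).
Definition mot_mul z w : motion R n :=
  (z.1 + z.2 *m w.1, so_mul z.2 w.2).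
Definition mot_inv z : motion R n :=
  (- (invmx z.2 *m z.1), so_inv z.2).

Definition mot_image z S : set 'cV[R]_n := [set z.1 + z.2 *m y | y in S].

Definition mot_measure (haar : probability (SO R n) R) :
    {measure set (motion R n) -> \bar R} :=
  (lebesgue_cv R n \x haar)%E.

End motion_group.

Section complex_integral.
Context d (T : measurableType d) (R : realType).
Variable mu : {measure set T -> \bar R}.
Implicit Type g : T -> R[i].

Definition cintegrable g : Prop :=
  mu.-integrable setT (fun t => (complex.Re (g t))%:E) /\
  mu.-integrable setT (fun t => (complex.Im (g t))%:E).

Definition cintegral g : R[i] :=
  ((\int[mu]_t complex.Re (g t)) +i* (\int[mu]_t complex.Im (g t)))%C.

End complex_integral.

(* In R[i], [0 <= c] means that c is real and nonnegative. *)
Definition positive_type (R : realType) n (haar : probability (SO R n) R)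
    (f : motion R n -> R[i]) : Prop :=
  let mu := mot_measure haar in
  (forall z, f z = (f (mot_inv z))^*) /\
  (forall rho : motion R n -> R[i], cintegrable mu rho ->
     0 <= cintegral mu (fun z => cintegral mu (fun w =>
            f (mot_mul (mot_inv w) z) * rho z * (rho w)^*))).

Section packings.
Variables (R : realType) (n : nat).
Implicit Types K P : set 'cV[R]_n.

Definition convex_body K : Prop :=
  [/\ compact K, convex_set K & K° !=set0].

(* The library's [ball] on matrices is the one of the sup norm. *)
Definition euclidean_ball (p : 'cV[R]_n) (r : R) : set 'cV[R]_n :=
  [set x | Num.sqrt (\sum_i (x i ord0 - p i ord0) ^+ 2) <= r].

Definition congruent_copy K (C : set 'cV[R]_n) : Prop :=
  exists z : motion R n, C = mot_image z K.

Definition packing K P : Prop :=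
  exists Cs : set (set 'cV[R]_n),
    [/\ forall C, Cs C -> congruent_copy K C,
        forall C D, Cs C -> Cs D -> C <> D -> C° `&` D° = set0
      & P = \bigcup_(C in Cs) C].

Local Notation vol := (lebesgue_cv R n).

Definition upper_density P : \bar R :=
  limf_esup (fun r : R =>
    ereal_sup [set (vol (euclidean_ball p r `&` P) / vol (euclidean_ball p r))%E
              | p in [set: 'cV[R]_n]]) +oo%R.

End packings.

(* Main.v *)
From HB Require Import structures.
Require Import Defs.
From mathcomp Require Import all_boot all_order all_algebra.
From mathcomp Require Import all_classical all_reals all_analysis.
From mathcomp Require Import complex measurable_realfun ring lra.

(* Let mu be the product measure on M(n); it is left-invariant, because Lebesgue
   measure is invariant under translations and rotations.  Let z_1, ..., z_N be
   the motions of the copies of K that meet the ball B(p, r), let U be a small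
   neighbourhood of the identity of M(n), and let B = B(p, S) x SO(n), where S is
   slightly larger than r.  Positive type is applied directly to
     rho = sum_i 1_(z_i U) / mu(U) - c 1_B,
   so that no periodization of the packing is needed.  With
   q(E, F) = int_E int_F f(w^-1 z) dw dz this gives
     0 <= mu(U)^-2 sum_(i,j) q(z_i U, z_j U)
          - 2 c mu(U)^-1 sum_i q(z_i U, B) + c^2 q(B, B).
   When U shrinks, the first term is at most N f(0, I) up to an arbitrarily small
   error, since the off-diagonal values f(z_j^-1 z_i) are nonpositive.  As f is
   integrable, int_B f(w^-1 z) dw is within eps of lambda for z well inside B, so
   that q(z_i U, B) is about lambda mu(U) and q(B, B) is about lambda vol B(p, S).
   Taking c = N / vol B(p, S) gives N (lambda - o(1)) <= f(0, I) vol B(p, S). *)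

Set Implicit Arguments.
Unset Strict Implicit.
Unset Printing Implicit Defensive.

Import Order.TTheory GRing.Theory Num.Theory.
Import numFieldNormedType.Exports.

Local Open Scope classical_set_scope.
Local Open Scope ring_scope.

(** * Measure-preserving maps and Lebesgue measure *)

(** Point masses at the [z i] would be the natural test measure, but positive type only allows
    integrable densities; the set [U] smears them out. Plain continuity of [f] suffices for this,
    because for a fixed configuration only the [N ^ 2] values at [z_j^-1 z_i] matter, and [U]
    disappears from the inequality before the radius grows. The cylinder must reach beyond the
    centres by 1, so that it sees all of [z_i U], and then by [L], beyond which the integral of
    [|f|] is at most [eps]. In the outer shell the slice is only bounded by the L1 norm; this is
    harmless because the shell's share of the volume tends to 0. The value [c = N / V] minimises
    [- 2 c N lambda + c^2 lambda V], the model expression in which all errors are dropped. All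
    thresholds on [r] are independent of the centre [p], as the supremum over [p] in the upper
    density demands. Since [lebesgue_cv] is an iterated product, rotation invariance is not visible
    in its definition; it is extracted from translation invariance by evaluating a double integral
    in two ways and comparing with the unit ball, which rotations fix. *)

Definition preserves d (T : measurableType d) (R : realType)
    (mu : set T -> \bar R) (phi : T -> T) : Prop :=
  measurable_fun setT phi /\
  forall A, measurable A -> mu (phi @^-1` A) = mu A.

Lemma preimage_measurable d d' (T : measurableType d) (T' : measurableType d')
    (phi : T -> T') (A : set T') :
  measurable_fun setT phi -> measurable A -> measurable (phi @^-1` A).
Proof. by move=> mphi mA; rewrite -[_ @^-1` _]setTI; exact: mphi. Qed.

Section preserves.
Context d (T : measurableType d) (R : realType).

(** A product measure is determined by its values on rectangles, and the preimage of a rectangle is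
    again a rectangle. *)
Lemma preserves_prod d' (T' : measurableType d')
    (m1 : {sigma_finite_measure set T -> \bar R})
    (m2 : {sigma_finite_measure set T' -> \bar R}) phi psi :
  preserves m1 phi -> preserves m2 psi ->
  preserves (m1 \x m2)%E (fun z => (phi z.1, psi z.2)).
Proof.
move=> [mphi pphi] [mpsi ppsi].
have mp : measurable_fun setT (fun z : T * T' => (phi z.1, psi z.2)).
  apply: measurable_fun_pair.
    by apply: measurableT_comp.
  by apply: measurableT_comp.
split => // A mA; apply/esym.
have := @product_measure_unique _ _ _ _ R m1 m2
  (measure_function_pushforward__canonical__measure_function_Measure (m1 \x m2)%E mp).
apply => // B C mB mC.
rewrite /= /pushforward.
have -> : (fun z : T * T' => (phi z.1, psi z.2)) @^-1` (B `*` C)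
  = (phi @^-1` B) `*` (psi @^-1` C) by [].
rewrite !product_measure1E//; last 2 first.
  exact: preimage_measurable.
  exact: preimage_measurable.
by congr (_ * _)%E; [exact: pphi|exact: ppsi].
Qed.

Lemma preserves_integral (mu : {measure set T -> \bar R}) phi (f : T -> \bar R) :
  preserves mu phi -> measurable_fun setT f -> (forall x, 0 <= f x)%E ->
  (\int[mu]_x f (phi x) = \int[mu]_x f x)%E.
Proof.
move=> [mphi pphi] mf f0.
transitivity (\int[pushforward mu phi]_x f x)%E.
  by rewrite ge0_integral_pushforward//.
apply: (@eq_measure_integral _ _ _ setT mu
  (measure_function_pushforward__canonical__measure_function_Measure mu mphi)).
by move=> A mA _; exact: pphi.
Qed.

End preserves.

Lemma preserves_lebesgue_addr (R : realType) (a : R) :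
  preserves (@lebesgue_measure R) (fun x => x + a : measurableTypeR R).
Proof.
have ma : measurable_fun setT (fun x : measurableTypeR R => x + a : measurableTypeR R).
  by apply: measurable_funD.
split => // A mA; apply/esym.
apply: (@lebesgue_measure_unique R
  (measure_function_pushforward__canonical__measure_function_Measure
     (@lebesgue_measure R) ma)) => // _ [[b c]] _ <- /=.
rewrite /pushforward.
have -> : (fun x : R => x + a) @^-1` `]b, c]%classic = `]b - a, c - a]%classic.
  by apply/seteqP; split => x /=; rewrite !in_itv/= ltrBlDr lerBrDr.
by rewrite !lebesgue_measure_itv/= !lte_fin ltrD2r -!EFinD opprB addrA subrK.
Qed.

Section lebesgue_cv.
Variable R : realType.

(** The closed ball of the sup norm. Its volume follows from the recursion behind [lebesgue_cv], and
    the volumes of Euclidean balls are calibrated against it. *)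
Definition cube n (s : R) : set 'cV[R]_n := [set x | forall i, `|x i ord0| <= s].

Lemma measurable_cube n s : measurable (@cube n s).
Proof.
have -> : @cube n s = \bigcap_(i in [set: 'I_n])
    ((fun x : 'cV[R]_n => x i ord0) @^-1` `[- s, s]%classic).
  apply/seteqP; split => x /= xs i; first by move=> _ /=; rewrite in_itv/= -ler_norml.
  by have := xs i I; rewrite /= in_itv/= -ler_norml.
apply: fin_bigcap_measurable; first exact: finite_finset.
by move=> i _; apply: preimage_measurable => //; exact: measurable_mx_entry.
Qed.

Lemma cv_cons0 n (p : 'cV[R]_n * measurableTypeR R) : cv_cons p ord0 ord0 = p.2.
Proof.
rewrite /cv_cons (_ : ord0 = lshift n (ord0 : 'I_1)); last exact: val_inj.
by rewrite [LHS](@col_mxEu R 1 n 1) mxE.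
Qed.

Lemma cv_consS n (p : 'cV[R]_n * measurableTypeR R) i :
  cv_cons p (lift ord0 i) ord0 = p.1 i ord0.
Proof.
rewrite /cv_cons (_ : lift ord0 i = rshift 1 i); last exact: val_inj.
by rewrite [LHS](@col_mxEd R 1 n 1).
Qed.

Lemma lebesgue_cv_cube n s : 0 <= s ->
  lebesgue_cv R n (cube s) = ((2 * s) ^+ n)%:E.
Proof.
move=> s0; elim: n => [|n IH].
  rewrite /= /dirac/= indicE mem_set ?expr0//.
  by case.
rewrite [LHS]/= /lebesgue_cv_extend /pushforward.
have -> : @cv_cons R n @^-1` cube s = cube s `*` `[- s, s]%classic.
  apply/seteqP; split => -[x a] /=.
    move=> xs; split.
      by move=> i; have := xs (lift ord0 i); rewrite cv_consS.
    by have := xs ord0; rewrite cv_cons0 in_itv/= -ler_norml.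
  move=> [xs]; rewrite in_itv/= -ler_norml => a_s i.
  by case: (unliftP ord0 i) => [j ->|->]; rewrite ?cv_consS ?cv_cons0//; exact: xs.
have E : @lebesgue_measure R `[- s, s]%classic = (2 * s)%:E.
  rewrite lebesgue_measure_itv/= lte_fin -EFinB opprK.
  (* The second case is [s = 0], where the length of the interval is 0 by default. *)
  case: ltP => [_|ss]; first by congr EFin; ring.
  by congr EFin; lra.
rewrite product_measure1E//; last exact: measurable_cube.
by rewrite exprSr EFinM; congr (_ * _)%E.
Qed.

Lemma lebesgue_cv_sigma_finite n : sigma_finite setT (lebesgue_cv R n).
Proof.
exists (fun k => @cube n k%:R).
  apply/seteqP; split => // x _.
  exists (Num.Def.truncn `|x|).+1 => // i.
  apply: le_trans (ltW (truncnS_gt _)).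
  rewrite [leRHS]/Num.Def.normr/= mx_normrE.
  exact: (le_bigmax _ (fun ij => `|x ij.1 ij.2|) (i, ord0)).
by move=> i; split; [exact: measurable_cube|rewrite lebesgue_cv_cube// ltry].
Qed.

(* A synonym that can carry the sigma-finite instance. *)
Definition lebesgue_cv_sf n : set 'cV[R]_n -> \bar R := lebesgue_cv R n.

HB.instance Definition _ n := isMeasure.Build _ _ _ (@lebesgue_cv_sf n)
  (measure0 (lebesgue_cv R n)) (measure_ge0 (lebesgue_cv R n))
  (@measure_semi_sigma_additive _ _ _ (lebesgue_cv R n)).

HB.instance Definition _ n := Measure_isSigmaFinite.Build _ _ _
  (@lebesgue_cv_sf n) (@lebesgue_cv_sigma_finite n).

(** Through [cv_cons] a translation splits into one of the first coordinate and one of the remaining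
    column, so [preserves_prod] carries the induction on the dimension. *)
Lemma preserves_lebesgue_cv_addr n (t : 'cV[R]_n) :
  preserves (lebesgue_cv R n) (fun x => x + t).
Proof.
have mt m (u : 'cV[R]_m) : measurable_fun setT (fun x : 'cV[R]_m => x + u).
  apply: measurable_fun_mxP => i j; rewrite (_ : (fun _ => _) = (fun x : 'cV[R]_m => x i j + u i j)).
    by apply: measurable_funD => //; exact: measurable_mx_entry.
  by apply/funext => x; rewrite mxE.
elim: n t => [|n IH] t.
  split=> [|A mA]; first exact: mt.
  congr (lebesgue_cv R 0 _); apply/seteqP; split => x /=;
    by rewrite [x + t]flatmx0 [x]flatmx0.
split=> [|A mA]; first exact: mt.
rewrite /= /lebesgue_cv_extend /pushforward.
pose t' : 'cV[R]_n := \col_i t (lift ord0 i) ord0.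
have [_ E] := preserves_prod (m1 := @lebesgue_cv_sf n) (m2 := @lebesgue_measure R)
  (IH t') (preserves_lebesgue_addr (t ord0 ord0)).
have mcA : measurable (@cv_cons R n @^-1` A).
  by apply: preimage_measurable => //; exact: measurable_cv_cons.
have consD p : cv_cons p + t = cv_cons (p.1 + t', p.2 + t ord0 ord0).
  apply/colP => i; rewrite mxE.
  by case: (unliftP ord0 i) => [j ->|->]; rewrite ?cv_consS ?cv_cons0/= ?mxE.
rewrite -[RHS](E _ mcA); congr (_ _).
by apply/seteqP; split => p /=; rewrite consD.
Qed.

End lebesgue_cv.

(** * Euclidean norm and linear changes of variables *)

Section euclidean.
Variable R : realType.

Definition enorm n (x : 'cV[R]_n) : R := Num.sqrt (\sum_i x i ord0 ^+ 2).

Lemma euclidean_ballE n (p : 'cV[R]_n) r :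
  euclidean_ball p r = [set x | enorm (x - p) <= r].
Proof.
apply/funext => x; rewrite /euclidean_ball /= /enorm.
by under [in RHS]eq_bigr do rewrite !mxE.
Qed.

(** The sum of the squares of [b * x i - c * y i] equals [b * (a * b - c ^+ 2)]; divide by [b], or
    note that all [y i] vanish when [b = 0]. *)
Lemma cauchy_schwarz_sum n (x y : 'I_n -> R) :
  (\sum_i x i * y i) ^+ 2 <= (\sum_i x i ^+ 2) * (\sum_i y i ^+ 2).
Proof.
set a := \sum_i x i ^+ 2; set b := \sum_i y i ^+ 2; set c := \sum_i x i * y i.
have b0 : 0 <= b by apply: sumr_ge0 => i _; exact: sqr_ge0.
have [b_eq0|b_neq0] := eqVneq b 0.
  have y0 i : y i = 0.
    have /eqP : y i ^+ 2 = 0 by apply: (psumr_eq0P _ b_eq0) => // k _; exact: sqr_ge0.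
    by rewrite sqrf_eq0 => /eqP.
  by rewrite b_eq0 mulr0 /c big1 ?expr0n// => i _; rewrite y0 mulr0.
have {b_neq0}b_gt0 : 0 < b by rewrite lt_def b_neq0.
have : 0 <= \sum_i (b * x i - c * y i) ^+ 2 by apply: sumr_ge0 => i _; exact: sqr_ge0.
have sumE u v : \sum_i (u * x i - v * y i) ^+ 2 =
    u ^+ 2 * a - 2 * u * v * c + v ^+ 2 * b.
  rewrite /a /b /c !mulr_sumr -sumrN -!big_split/=.
  by apply: eq_bigr => i _; ring.
rewrite sumE (_ : _ + _ = b * (a * b - c ^+ 2)); last by ring.
by rewrite pmulr_rge0// subr_ge0.
Qed.

Lemma enorm_ge0 n (x : 'cV[R]_n) : 0 <= enorm x.
Proof. exact: sqrtr_ge0. Qed.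

Lemma sqr_enorm n (x : 'cV[R]_n) : enorm x ^+ 2 = \sum_i x i ord0 ^+ 2.
Proof. by rewrite sqr_sqrtr// sumr_ge0// => i _; exact: sqr_ge0. Qed.

Lemma enormD n (x y : 'cV[R]_n) : enorm (x + y) <= enorm x + enorm y.
Proof.
rewrite -ler_sqr ?nnegrE ?enorm_ge0 ?addr_ge0 ?enorm_ge0//.
rewrite sqrrD !sqr_enorm.
set c := \sum_i x i ord0 * y i ord0.
have -> : \sum_i (x + y) i ord0 ^+ 2 =
    \sum_i x i ord0 ^+ 2 + c *+ 2 + \sum_i y i ord0 ^+ 2.
  rewrite -mulr_natl mulr_sumr -!big_split/=.
  by apply: eq_bigr => i _; rewrite mxE; ring.
rewrite lerD2r lerD2l lerMn2r/= (le_trans (ler_norm _))//.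
rewrite -ler_sqr ?nnegrE ?mulr_ge0 ?enorm_ge0// -normrX ger0_norm ?sqr_ge0//.
by rewrite exprMn !sqr_enorm; exact: cauchy_schwarz_sum.
Qed.

Lemma enormN n (x : 'cV[R]_n) : enorm (- x) = enorm x.
Proof. by congr Num.sqrt; apply: eq_bigr => i _; rewrite mxE sqrrN. Qed.

Lemma enormZ n (a : R) (x : 'cV[R]_n) : enorm (a *: x) = `|a| * enorm x.
Proof.
rewrite /enorm -sqrtr_sqr -sqrtrM ?sqr_ge0// mulr_sumr.
by congr Num.sqrt; apply: eq_bigr => i _; rewrite mxE exprMn.
Qed.

Lemma enorm0 n : enorm (0 : 'cV[R]_n) = 0.
Proof. by rewrite -(scale0r 0) enormZ normr0 mul0r. Qed.

Lemma le_coord_enorm n (x : 'cV[R]_n) i : `|x i ord0| <= enorm x.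
Proof.
rewrite -sqrtr_sqr ler_wsqrtr// (bigD1 i)//= lerDl.
by apply: sumr_ge0 => j _; exact: sqr_ge0.
Qed.

Lemma enorm_cube n (s : R) (x : 'cV[R]_n) : cube s x -> enorm x <= n%:R * s.
Proof.
move=> xs; case: n x xs => [|n] x xs.
  by rewrite /enorm big_ord0 sqrtr0 mul0r.
have s0 : 0 <= s by apply: le_trans (xs ord0).
rewrite -ler_sqr ?nnegrE ?enorm_ge0 ?mulr_ge0// sqr_enorm exprMn.
apply: (@le_trans _ _ (\sum_(i < n.+1) s ^+ 2)).
  apply: ler_sum => i _; rewrite -[leLHS]ger0_norm ?sqr_ge0// normrX.
  by rewrite ler_sqr ?nnegrE// xs.
rewrite sumr_const card_ord -[leLHS]mulr_natl ler_wpM2r ?sqr_ge0//.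
(* The factor [n] instead of its square root costs only [n.+1 <= n.+1 ^ 2]. *)
by rewrite -natrX ler_nat -{1}(expn1 n.+1) leq_pexp2l.
Qed.

Lemma enorm_SO n (A : SO R n) (x : 'cV[R]_n) : enorm (A *m x) = enorm x.
Proof.
have dotE (y : 'cV[R]_n) : \sum_i y i ord0 ^+ 2 = (y^T *m y) ord0 ord0.
  by rewrite mxE; apply: eq_bigr => i _; rewrite mxE expr2.
case: A => A /= /andP[/eqP AA _].
by rewrite /enorm !dotE trmx_mul -mulmxA (mulmxA A^T) AA mul1mx.
Qed.

Lemma measurable_enorm n : measurable_fun setT (@enorm n).
Proof.
apply: (@measurableT_comp _ _ _ _ _ _ (@Num.sqrt R)).
  by apply: continuous_measurable_fun; exact: sqrt_continuous.
apply: measurable_sum => i; apply: (@measurable_funX _ _ _ _ (fun x : 'cV[R]_n => x i ord0)).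
exact: measurable_mx_entry.
Qed.

Lemma measurable_cv_addr n (t : 'cV[R]_n) : measurable_fun setT (fun x : 'cV[R]_n => x + t).
Proof. by have [] := preserves_lebesgue_cv_addr t. Qed.

Lemma measurable_euclidean_ball n (p : 'cV[R]_n) r :
  measurable (euclidean_ball p r).
Proof.
rewrite euclidean_ballE.
have -> : [set x | enorm (x - p) <= r] =
    (fun x => enorm (x - p)) @^-1` `]-oo, r]%classic.
  by apply/seteqP; split => x /=; rewrite in_itv.
apply: preimage_measurable => //.
apply: measurableT_comp; first exact: measurable_enorm.
exact: measurable_cv_addr.
Qed.

End euclidean.

(** * Additive maps and translation-invariant measures *)

Section change_of_variables.
Variables (R : realType) (n : nat).
Variable mu : {sigma_finite_measure set 'cV[R]_n -> \bar R}.
Hypothesis mu_addr : forall t, preserves mu (fun x => x + t).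

Lemma measurable_EFin_indic (C : set 'cV[R]_n) : measurable C ->
  measurable_fun setT (fun x => (\1_C x)%:E : \bar R).
Proof. by move=> mC; apply/measurable_EFinP; exact: measurable_indic. Qed.

Lemma integral_indic_addr (C : set 'cV[R]_n) s : measurable C ->
  (\int[mu]_x (\1_C (x + s)%R)%:E = mu C)%E.
Proof.
move=> mC.
rewrite (preserves_integral (mu := mu) (mu_addr s) (measurable_EFin_indic mC)).
  by rewrite (integral_indic mu measurableT mC) setIT.
by move=> x; rewrite lee_fin.
Qed.

Lemma integral_indic_additive (S : 'cV[R]_n -> 'cV[R]_n) (C : set 'cV[R]_n) y :
  measurable_fun setT S -> {morph S : x y / x + y} ->
  (exists x, S x = y) -> measurable C ->
  (\int[mu]_x (\1_C (S x + y)%R)%:E = mu (S @^-1` C))%E.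
Proof.
move=> mS SD [s <-] mC.
rewrite -(integral_indic_addr s (preimage_measurable mS mC)).
apply: eq_integral => x _.
by rewrite !indicE; congr ((nat_of_bool _)%:R%:E); apply/idP/idP; rewrite !inE/= SD.
Qed.

Lemma measurable_cvD (g h : 'cV[R]_n * 'cV[R]_n -> 'cV[R]_n) :
  measurable_fun setT g -> measurable_fun setT h ->
  measurable_fun setT (fun z => g z + h z).
Proof.
move=> mg mh; apply: measurable_fun_mxP => i j.
rewrite (_ : (fun _ => _) = (fun z => g z i j + h z i j)); last first.
  by apply/funext => z; rewrite mxE.
by apply: measurable_funD;
  [exact: (measurableT_comp (measurable_mx_entry i j) mg)|
   exact: (measurableT_comp (measurable_mx_entry i j) mh)].
Qed.

Lemma measurable_cvN (S : 'cV[R]_n -> 'cV[R]_n) :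
  measurable_fun setT S -> measurable_fun setT (fun x => - S x).
Proof.
move=> mS; apply: measurable_fun_mxP => i j.
rewrite (_ : (fun _ => _) = (fun x : 'cV[R]_n => - S x i j)); last first.
  by apply/funext => x /=; rewrite mxE.
apply: measurableT_comp => //.
exact: (measurableT_comp (measurable_mx_entry i j) mS).
Qed.

(* Integrate over x first: y = S s turns S x + y into S (x + s), and the
   translation by s disappears. *)
Lemma fubini_indic_additive (S : 'cV[R]_n -> 'cV[R]_n) (A B : set 'cV[R]_n) :
  measurable_fun setT S -> {morph S : x y / x + y} ->
  (forall y, exists x, S x = y) -> measurable A -> measurable B ->
  (\int[mu]_x \int[mu]_y ((\1_A (S x + y)%R)%:E * (\1_B y)%:E) =
   mu (S @^-1` A) * mu B)%E.
Proof.
move=> mS SD Ssurj mA mB.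
pose F (z : 'cV[R]_n * 'cV[R]_n) : \bar R := ((\1_A (S z.1 + z.2)%R)%:E * (\1_B z.2)%:E)%E.
have mF : measurable_fun setT F.
  apply: emeasurable_funM.
    exact: (measurableT_comp (measurable_EFin_indic mA)
      (measurable_cvD (measurableT_comp mS measurable_fst) measurable_snd)).
  exact: (measurableT_comp (measurable_EFin_indic mB) measurable_snd).
have F0 z : (0 <= F z)%E by apply: mule_ge0; rewrite lee_fin.
rewrite (fubini_tonelli (m1 := mu) (m2 := mu) F mF F0) {mF F0}.
transitivity (\int[mu]_y (mu (S @^-1` A) * (\1_B y)%:E))%E.
  apply: eq_integral => y _; rewrite /F/= -(integral_indic_additive mS SD (Ssurj y) mA).
  rewrite (ge0_integralZr mu measurableT).
  - by [].
  - exact: (measurableT_comp (measurable_EFin_indic mA) (measurableT_comp (mu_addr y).1 mS)).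
  - by move=> x _; rewrite lee_fin.
  - by rewrite lee_fin.
rewrite (ge0_integralZl mu measurableT).
- by rewrite (integral_indic mu measurableT mB) setIT.
- exact: measurable_EFin_indic.
- by move=> x _; rewrite lee_fin.
- exact: measure_ge0.
Qed.

(* If B has positive finite measure and [(- T)^-1 B = B], then T preserves mu;
   with T a rotation and B a ball, this is rotation invariance. *)
Lemma additive_preimage_measure (T : 'cV[R]_n -> 'cV[R]_n) (A B : set 'cV[R]_n) :
  measurable_fun setT T -> {morph T : x y / x + y} ->
  (forall y, exists x, T x = y) -> measurable A -> measurable B ->
  (mu (T @^-1` A) * mu B = mu A * mu ((fun x => (- T x)%R) @^-1` B))%E.
Proof.
move=> mT TD Tsurj mA mB.
rewrite -(fubini_indic_additive mT TD Tsurj mA mB) muleC.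
have ND : {morph (fun x => - T x) : x y / x + y}.
  by move=> x y /=; rewrite TD opprD.
have Nsurj y : exists x, - T x = y.
  by have [x Tx] := Tsurj (- y); exists x; rewrite Tx opprK.
rewrite -(fubini_indic_additive (measurable_cvN mT) ND Nsurj mB mA).
apply: eq_integral => x _.
have mF : measurable_fun setT (fun y => (\1_A (T x + y)%R)%:E * (\1_B y)%:E : \bar R)%E.
  apply: emeasurable_funM; last exact: measurable_EFin_indic.
  rewrite (_ : (fun _ => _) = (fun y => (\1_A (y + T x)%R)%:E)).
    exact: (measurableT_comp (measurable_EFin_indic mA) (mu_addr (T x)).1).
  by apply/funext => y; rewrite addrC.
have F0 y : (0 <= (\1_A (T x + y)%R)%:E * (\1_B y)%:E :> \bar R)%E.
  by apply: mule_ge0; rewrite lee_fin.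
(* Translating [y] by [- T x] moves [T x] from the argument of [\1_A] to that of [\1_B], which
   exchanges the roles of [A] and [B] and replaces [T] by its opposite. *)
rewrite -(preserves_integral (mu := mu) (mu_addr (- T x)) mF F0).
apply: eq_integral => y _.
by rewrite addrC subrK muleC [y - _]addrC.
Qed.

End change_of_variables.

(** * Volume of balls and the motion group *)

Section ball_volume.
Variables (R : realType) (n : nat).
Local Notation vol := (lebesgue_cv R n).

(** The volume of the unit ball is kept as an abstract positive real: it cancels in every ratio of
    volumes. *)
Definition ball_const : R := fine (vol (euclidean_ball 0 1)).

Lemma euclidean_ball0E (r : R) : euclidean_ball 0 r = [set x : 'cV[R]_n | enorm x <= r].
Proof. by rewrite euclidean_ballE; apply/funext => x /=; rewrite subr0. Qed.

Lemma vol_unit_ball_lty : (vol (euclidean_ball 0 1) < +oo)%E.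
Proof.
apply: (@le_lt_trans _ _ (vol (cube 1))).
  apply: le_measure; rewrite ?inE; [exact: measurable_euclidean_ball|exact: measurable_cube|].
  by rewrite euclidean_ball0E => x /= x1 i; apply: le_trans x1; exact: le_coord_enorm.
by rewrite lebesgue_cv_cube// ltry.
Qed.

Lemma vol_unit_ballE : vol (euclidean_ball 0 1) = ball_const%:E.
Proof. by rewrite fineK// ge0_fin_numE// vol_unit_ball_lty. Qed.

Lemma ball_const_gt0 : 0 < ball_const.
Proof.
rewrite -lte_fin -vol_unit_ballE.
(* By [enorm_cube] this cube has Euclidean radius at most [n / n.+1], so it fits in the unit ball;
   the successor also covers dimension 0. *)
apply: (@lt_le_trans _ _ (vol (cube n.+1%:R^-1))).
  by rewrite lebesgue_cv_cube ?invr_ge0// lte_fin exprn_gt0// mulr_gt0// invr_gt0.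
apply: le_measure; rewrite ?inE; [exact: measurable_cube|exact: measurable_euclidean_ball|].
rewrite euclidean_ball0E => x /= /enorm_cube /le_trans; apply.
by rewrite ler_pdivrMr// mul1r ler_nat.
Qed.

Lemma preserves_lebesgue_cv_SO (A : SO R n) :
  preserves vol (fun x : 'cV[R]_n => A *m x).
Proof.
have mA : measurable_fun setT (fun x : 'cV[R]_n => A *m x).
  apply: measurable_fun_mxP => i j.
  rewrite (_ : (fun _ => _) = fun x : 'cV[R]_n => \sum_k A i k * x k j); last first.
    by apply/funext => x; rewrite mxE.
  apply: measurable_sum => k; apply: measurable_funM => //.
  exact: measurable_mx_entry.
have [AT A1] : (A : 'M[R]_n)^T *m A = 1%:M /\ (A : 'M[R]_n) *m A^T = 1%:M.
  by case: A {mA} => A /= /andP[/eqP AA _]; split => //; exact: mulmx1C.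
split => // E mE.
have AD : {morph (fun x : 'cV[R]_n => A *m x) : x y / x + y}.
  by move=> x y; rewrite mulmxDr.
have Asurj (y : 'cV[R]_n) : exists x, A *m x = y.
  by exists (A^T *m y); rewrite mulmxA A1 mul1mx.
have H := additive_preimage_measure (mu := @lebesgue_cv_sf R n)
  (@preserves_lebesgue_cv_addr R n) mA AD Asurj mE (@measurable_euclidean_ball R n 0 1).
have ballE : (fun x : 'cV[R]_n => - (A *m x)) @^-1` euclidean_ball 0 1 = euclidean_ball 0 1.
  by rewrite euclidean_ball0E; apply/funext => x /=; rewrite enormN enorm_SO.
rewrite ballE in H.
have {}H : (vol ((fun x : 'cV[R]_n => A *m x) @^-1` E) * vol (euclidean_ball 0 1) =
  vol E * vol (euclidean_ball 0 1))%E := H.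
move: H; rewrite vol_unit_ballE => /(congr1 (fun x => x * (ball_const^-1)%:E)%E).
by rewrite -!muleA -!EFinM mulfV ?mule1// gt_eqF// ball_const_gt0.
Qed.

(** [additive_preimage_measure] is used with the scaling by [r^-1], the unit ball and the unit cube:
    the unknown ratio of two balls becomes the known ratio of two cubes. *)
Lemma vol_euclidean_ball (p : 'cV[R]_n) r : 0 < r ->
  vol (euclidean_ball p r) = (r ^+ n * ball_const)%:E.
Proof.
move=> r0.
have -> : vol (euclidean_ball p r) = vol (euclidean_ball 0 r).
  have [_ /(_ _ (measurable_euclidean_ball 0 r)) <-] := preserves_lebesgue_cv_addr (- p).
  by rewrite euclidean_ballE euclidean_ball0E.
have mZ : measurable_fun setT (fun x : 'cV[R]_n => r^-1 *: x).
  apply: measurable_fun_mxP => i j.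
  rewrite (_ : (fun _ => _) = fun x : 'cV[R]_n => r^-1 * x i j); last first.
    by apply/funext => x; rewrite mxE.
  by apply: measurable_funM => //; exact: measurable_mx_entry.
have ZD : {morph (fun x : 'cV[R]_n => r^-1 *: x) : x y / x + y}.
  by move=> x y; rewrite scalerDr.
have Zsurj (y : 'cV[R]_n) : exists x, r^-1 *: x = y.
  by exists (r *: y); rewrite scalerA mulVf ?scale1r// gt_eqF.
have H := additive_preimage_measure (mu := @lebesgue_cv_sf R n)
  (@preserves_lebesgue_cv_addr R n) mZ ZD Zsurj
  (@measurable_euclidean_ball R n 0 1) (@measurable_cube R n 1).
have ballE : (fun x : 'cV[R]_n => r^-1 *: x) @^-1` euclidean_ball 0 1 = euclidean_ball 0 r.
  rewrite !euclidean_ball0E; apply/funext => x /=.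
  by rewrite enormZ gtr0_norm ?invr_gt0// ler_pdivrMl// mulr1.
have cubeE : (fun x : 'cV[R]_n => - (r^-1 *: x)) @^-1` cube 1 = cube r.
  apply/seteqP; split => x /= xr i; have := xr i.
    by rewrite !mxE normrN normrM gtr0_norm ?invr_gt0// ler_pdivrMl// mulr1.
  by rewrite !mxE normrN normrM gtr0_norm ?invr_gt0// ler_pdivrMl// mulr1.
rewrite ballE cubeE in H.
have {}H : (vol (euclidean_ball 0 r) * vol (cube 1) =
  vol (euclidean_ball 0 1) * vol (cube r))%E := H.
rewrite (lebesgue_cv_cube n ler01) (lebesgue_cv_cube n (ltW r0)) vol_unit_ballE in H.
(* Finiteness comes first: an infinite volume would make the left side of [H] infinite while the
   right side is finite. *)
have /fineK volK : vol (euclidean_ball 0 r) \is a fin_num.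
  have := leey (vol (euclidean_ball 0 r)); rewrite le_eqVlt => /predU1P[volE|].
    by move: H; rewrite volE gt0_mulye// lte_fin exprn_gt0// mulr1.
  by rewrite ge0_fin_numE.
move: H; rewrite -volK -!EFinM => -[] H; congr EFin.
have two_n : (2 : R) ^+ n != 0 by rewrite expf_neq0.
by apply: (mulIf two_n); move: H; rewrite mulr1 exprMn => ->; ring.
Qed.

End ball_volume.

Section special_orthogonal.
Variables (R : realType) (n : nat).
Implicit Types A B C : SO R n.

Lemma so_trmxK A : (A : 'M[R]_n)^T *m A = 1%:M.
Proof. by case: A => A /= /andP[/eqP]. Qed.

Lemma so_trmxKr A : (A : 'M[R]_n) *m A^T = 1%:M.
Proof. exact: mulmx1C (so_trmxK A). Qed.

Lemma so_invmx A : invmx A = (A : 'M[R]_n)^T.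
Proof.
have [uA _] := mulmx1_unit (so_trmxKr A).
by rewrite -[LHS]mulmx1 -(so_trmxKr A) mulmxA mulVmx// mul1mx.
Qed.

Lemma so_inj A B : (A : 'M[R]_n) = B -> A = B.
Proof. exact: val_inj. Qed.

Lemma so_mulA A B C : so_mul A (so_mul B C) = so_mul (so_mul A B) C.
Proof. by apply: so_inj; rewrite /= mulmxA. Qed.

Lemma so_mul1 A : so_mul (so_one R n) A = A.
Proof. by apply: so_inj; rewrite /= mul1mx. Qed.

Lemma so_mulV A : so_mul (so_inv A) A = so_one R n.
Proof. by apply: so_inj; rewrite /= so_invmx so_trmxK. Qed.

Lemma so_mulrV A : so_mul A (so_inv A) = so_one R n.
Proof. by apply: so_inj; rewrite /= so_invmx so_trmxKr. Qed.

Lemma measurable_so_mx : measurable_fun setT (@so_mx R n).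
Proof. by move=> _ Y mY; exists Y. Qed.

Lemma measurable_fun_SO d (T : measurableType d) (f : T -> SO R n) :
  measurable_fun setT (fun t => so_mx (f t)) -> measurable_fun setT f.
Proof.
by move=> mf _ _ [Y mY <-]; rewrite !setTI -[_ @^-1` _](setTI) -comp_preimage; exact: mf.
Qed.

(** [is_haar] is about images and [preserves] about preimages; they match because left translation
    is a bijection, with inverse the translation by [so_inv A]. *)
Lemma preserves_haar (haar : probability (SO R n) R) A :
  is_haar haar -> preserves haar (so_mul A).
Proof.
move=> haarP.
have mA : measurable_fun setT (so_mul A).
  apply: measurable_fun_SO; apply: measurable_fun_mxP => i j.
  rewrite (_ : (fun _ => _) = fun B : SO R n => \sum_k A i k * so_mx B k j); last first.
    by apply/funext => x; rewrite mxE.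
  apply: measurable_sum => k; apply: measurable_funM => //.
  exact: (measurableT_comp (measurable_mx_entry k j) measurable_so_mx).
split => // E mE.
rewrite -(haarP A); last exact: preimage_measurable.
congr (_ _); apply/seteqP; split => [_ [B EB <-]//|B EB].
by exists (so_mul (so_inv A) B); rewrite /= so_mulA so_mulrV so_mul1.
Qed.

End special_orthogonal.

Section motion_group.
Variables (R : realType) (n : nat).
Implicit Types z w : motion R n.

Lemma mot_eq z w : z.1 = w.1 -> z.2 = w.2 -> z = w.
Proof. by case: z w => [? ?] [? ?] /= -> ->. Qed.

Lemma mot_mulA z w u : mot_mul z (mot_mul w u) = mot_mul (mot_mul z w) u.
Proof. by apply: mot_eq => /=; rewrite ?so_mulA// mulmxDr addrA mulmxA. Qed.

Lemma mot_mul1 z : mot_mul (mot_one R n) z = z.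
Proof. by apply: mot_eq => /=; rewrite ?so_mul1// mul1mx add0r. Qed.

Lemma mot_mulV z : mot_mul (mot_inv z) z = mot_one R n.
Proof. by apply: mot_eq => /=; rewrite ?so_mulV// addNr. Qed.

Lemma mot_mulrV z : mot_mul z (mot_inv z) = mot_one R n.
Proof.
by apply: mot_eq => /=; rewrite ?so_mulrV// mulmxN mulmxA so_invmx so_trmxKr mul1mx subrr.
Qed.

Lemma mot_mulKV z w : mot_mul z (mot_mul (mot_inv z) w) = w.
Proof. by rewrite mot_mulA mot_mulrV mot_mul1. Qed.

Lemma mot_mulK z w : mot_mul (mot_inv z) (mot_mul z w) = w.
Proof. by rewrite mot_mulA mot_mulV mot_mul1. Qed.

Lemma mot_mulr1 z : mot_mul z (mot_one R n) = z.
Proof. by rewrite -(mot_mulV z) mot_mulKV. Qed.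

Lemma mot_inv_unique z w : mot_mul z w = mot_one R n -> mot_inv z = w.
Proof. by move=> zw; rewrite -(mot_mulr1 (mot_inv z)) -zw mot_mulK. Qed.

Lemma mot_invM z w : mot_inv (mot_mul z w) = mot_mul (mot_inv w) (mot_inv z).
Proof. by apply: mot_inv_unique; rewrite -mot_mulA mot_mulKV mot_mulrV. Qed.

Lemma mot_invK z : mot_inv (mot_inv z) = z.
Proof. by apply: mot_inv_unique; rewrite mot_mulV. Qed.

(** Images are awkward for measurability, openness and measure; as a preimage under the inverse
    motion, a moved set inherits all three. *)
Lemma mot_image_preimage z S :
  mot_image z S = (fun x => (mot_inv z).1 + (mot_inv z).2 *m x) @^-1` S.
Proof.
have E1 (x : 'cV[R]_n) : (mot_inv z).1 + (mot_inv z).2 *m (z.1 + z.2 *m x) = x.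
  by rewrite /= mulmxDr addKr mulmxA so_invmx so_trmxK mul1mx.
have E2 (x : 'cV[R]_n) : z.1 + z.2 *m ((mot_inv z).1 + (mot_inv z).2 *m x) = x.
  by rewrite /= mulmxDr mulmxN !mulmxA so_invmx so_trmxKr !mul1mx addNKr.
apply/seteqP; split => [_ [x Sx <-]|x /= Sx]; first by rewrite /preimage/= E1.
by eexists; [exact: Sx|exact: E2].
Qed.

Lemma mot_image_mul z w S : mot_image z (mot_image w S) = mot_image (mot_mul z w) S.
Proof.
apply/seteqP; split => [_ [_ [x Sx <-] <-]|_ [x Sx <-]].
  by exists x => //=; rewrite mulmxDr addrA mulmxA.
by exists (w.1 + w.2 *m x); [exists x|rewrite /= mulmxDr addrA mulmxA].
Qed.

(** This is the map under the kernel [f (w^-1 z)]. Inversion in SO(n) is transposition, so every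
    entry of the result is a polynomial in the entries of the two motions. *)
Lemma measurable_mot_div : measurable_fun setT
  (fun p : motion R n * motion R n => mot_mul (mot_inv p.2) p.1).
Proof.
have mv (i : 'I_n) : measurable_fun setT (fun z : motion R n => z.1 i ord0).
  exact: (measurableT_comp (measurable_mx_entry i ord0) measurable_fst).
have mA i j : measurable_fun setT (fun z : motion R n => so_mx z.2 i j).
  apply: (measurableT_comp (measurable_mx_entry i j)).
  exact: (measurableT_comp (@measurable_so_mx R n) measurable_snd).
apply: measurable_fun_pair; last first.
  apply: measurable_fun_SO; apply: measurable_fun_mxP => i j.
  rewrite (_ : (fun _ => _) = fun p : motion R n * motion R n =>
      \sum_k so_mx p.2.2 k i * so_mx p.1.2 k j); last first.
    apply/funext => p; rewrite /= so_invmx mxE.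
    by apply: eq_bigr => k _; rewrite mxE.
  apply: measurable_sum => k; apply: measurable_funM.
    exact: (measurableT_comp (mA k i) measurable_snd).
  exact: (measurableT_comp (mA k j) measurable_fst).
apply: measurable_fun_mxP => i j.
rewrite (_ : (fun _ => _) = fun p : motion R n * motion R n =>
    \sum_k so_mx p.2.2 k i * (p.1.1 k ord0 - p.2.1 k ord0)); last first.
  apply/funext => p; rewrite /= !so_invmx [j]ord1 addrC -mulmxBr mxE.
  by apply: eq_bigr => k _; rewrite !mxE.
apply: measurable_sum => k; apply: measurable_funM.
  exact: (measurableT_comp (mA k i) measurable_snd).
apply: measurable_funB.
  exact: (measurableT_comp (mv k) measurable_fst).
exact: (measurableT_comp (mv k) measurable_snd).
Qed.

Lemma preserves_lebesgue_cv_mot z :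
  preserves (lebesgue_cv R n) (fun x : 'cV[R]_n => z.1 + z.2 *m x).
Proof.
have [mt pt] := preserves_lebesgue_cv_addr z.1.
have [mA pA] := preserves_lebesgue_cv_SO z.2.
have -> : (fun x : 'cV[R]_n => z.1 + z.2 *m x) =
    (fun x => x + z.1) \o (fun x : 'cV[R]_n => z.2 *m x).
  by apply/funext => x /=; rewrite addrC.
split; first exact: (measurableT_comp mt mA).
by move=> E mE; rewrite -(pt E mE) -(pA _ (preimage_measurable mt mE)).
Qed.

(** Left multiplication acts on the two factors separately, so the invariance of each factor is
    enough; right multiplication would mix them. *)
Lemma preserves_mot_mul (haar : probability (SO R n) R) z : is_haar haar ->
  preserves (mot_measure haar) (mot_mul z).
Proof.
move=> haarP.
by apply: (@preserves_prod _ _ R _ _ (@lebesgue_cv_sf R n) haar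
  (fun x => z.1 + z.2 *m x) (so_mul z.2));
  [exact: preserves_lebesgue_cv_mot|exact: preserves_haar].
Qed.

End motion_group.

(** * Quadratic forms with a bounded kernel *)

Section Rintegral_sum.
Context d (T : measurableType d) (R : realType).
Variable mu : {measure set T -> \bar R}.

Lemma Rintegral_sum (D : set T) I (s : seq I) (h : I -> T -> R) :
  measurable D -> (forall i, mu.-integrable D (EFin \o h i)) ->
  \int[mu]_(x in D) (\sum_(i <- s) h i x) = \sum_(i <- s) \int[mu]_(x in D) h i x.
Proof.
move=> mD ih.
have isum t : mu.-integrable D (EFin \o (fun x => \sum_(i <- t) h i x)).
  apply: (eq_integrable mD (fun x => (\sum_(i <- t) (h i x)%:E)%E)).
    by move=> x _; rewrite /= sumEFin.
  by apply: integrable_sum => // i _; exact: ih.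
elim: s => [|i s IH].
  under eq_Rintegral do rewrite big_nil.
  by rewrite big_nil Rintegral_cst// mul0r.
under eq_Rintegral do rewrite big_cons.
by rewrite big_cons -IH RintegralD//; exact: ih.
Qed.

Lemma restrict_indicE (D : set T) (h : T -> R) x : (h \_ D) x = h x * \1_D x.
Proof. by rewrite patchE indicE; case: ifP => _; rewrite ?mulr1 ?mulr0. Qed.

End Rintegral_sum.

Section kernel_form.
Context d (T : measurableType d) (R : realType).
Variable mu : {sigma_finite_measure set T -> \bar R}.
Variables (k : T * T -> R) (M : R).
Hypothesis mk : measurable_fun setT k.
Hypothesis k_le : forall p, `|k p| <= M.
Hypothesis k_sym : forall z w, k (z, w) = k (w, z).

Definition finite_set_measure (E : set T) := measurable E /\ (mu E < +oo)%E.

Definition slice (F : set T) z : R := \int[mu]_(w in F) k (z, w).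

(** The form [q] of the overview for a general kernel. Being a real-valued integral it says nothing
    about integrability, which comes from the bound on [k] and the finite measure of the sets. *)
Definition kernel_form (E F : set T) : R := \int[mu]_(z in E) slice F z.

Lemma measurable_kernel_slice z : measurable_fun setT (fun w => k (z, w)).
Proof.
apply: (measurableT_comp (f := k) (g := fun w => (z, w)) mk).
by apply: measurable_fun_pair.
Qed.

Lemma integrable_slice z F : finite_set_measure F ->
  mu.-integrable F (EFin \o (fun w => k (z, w))).
Proof.
move=> [mF finF]; apply: measurable_bounded_integrable => //.
  by apply: measurable_funTS; exact: measurable_kernel_slice.
exists M; split; first exact: num_real.
by move=> x Mx w _; apply: le_trans (ltW Mx).
Qed.

(** A bounded kernel is integrable over a rectangle of finite measure but in general not over the
    whole product, so Fubini is only ever applied to restricted kernels. *)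
Lemma integrable_rect E F : finite_set_measure E -> finite_set_measure F ->
  (mu \x mu)%E.-integrable setT (EFin \o (k \_ (E `*` F))).
Proof.
move=> [mE finE] [mF finF]; rewrite -restrict_EFin.
have mEF : measurable (E `*` F) by exact: measurableX.
apply/(integrable_mkcond (D := E `*` F) (EFin \o k) mEF).
apply: measurable_bounded_integrable => //.
- rewrite [ltLHS](product_measure1E _ _ mE mF).
  by apply: lte_mul_pinfty => //; rewrite ge0_fin_numE.
- exact: measurable_funTS.
- exists M; split; first exact: num_real.
  by move=> x Mx w _; apply: le_trans (ltW Mx).
Qed.

Lemma rect_restrictE E F z w :
  (k \_ (E `*` F)) (z, w) = ((fun w => k (z, w)) \_ F) w * \1_E z.
Proof.
rewrite !restrict_indicE -mulrA; congr (_ * _).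
rewrite !indicE -natrM mulnb; congr (nat_of_bool _)%:R.
by apply/idP/andP; rewrite !inE/= => -[].
Qed.

Lemma fubini_F_rect E F z : finite_set_measure F ->
  fubini_F mu (EFin \o (k \_ (E `*` F))) z = ((slice F \_ E) z)%:E.
Proof.
move=> fF; have [mF _] := fF.
rewrite /fubini_F restrict_indicE EFinM.
transitivity (\int[mu]_w ((((fun w => k (z, w)) \_ F) w)%:E * (\1_E z)%:E))%E.
  by apply: eq_integral => w _; rewrite /= rect_restrictE EFinM.
have iF : mu.-integrable setT (fun w => (((fun w => k (z, w)) \_ F) w)%:E).
  rewrite (_ : (fun _ => _) = (EFin \o (fun w => k (z, w))) \_ F).
    by apply/(integrable_mkcond _ mF); exact: integrable_slice.
  by rewrite restrict_EFin.
rewrite (integralZr measurableT iF); congr (_ * _)%E.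
rewrite /slice Rintegral_mkcond /Rintegral fineK//.
exact: integrable_fin_num.
Qed.

Lemma integrable_slice_fun E F : finite_set_measure E -> finite_set_measure F ->
  mu.-integrable E (EFin \o slice F).
Proof.
move=> fE fF; have [mE _] := fE.
apply/(integrable_mkcond _ mE); rewrite restrict_EFin.
rewrite (_ : _ \o _ = fubini_F mu (EFin \o (k \_ (E `*` F)))).
  exact: integrable_fubini_F (integrable_rect fE fF).
by apply/funext => z; rewrite fubini_F_rect.
Qed.

Lemma kernel_formE E F : finite_set_measure E -> finite_set_measure F ->
  (kernel_form E F)%:E = (\int[mu]_z fubini_F mu (EFin \o (k \_ (E `*` F))) z)%E.
Proof.
move=> fE fF; have [mE _] := fE.
rewrite /kernel_form Rintegral_mkcond /Rintegral fineK.
  by apply: eq_integral => z _; rewrite fubini_F_rect.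
apply: integrable_fin_num => //.
rewrite (_ : (fun _ => _) = (EFin \o slice F) \_ E).
  by apply/(integrable_mkcond _ mE); exact: integrable_slice_fun.
by rewrite restrict_EFin.
Qed.

(** Fubini on the rectangle together with the symmetry of [k]; it later merges the two cross terms
    of the quadratic form. *)
Lemma kernel_form_sym E F : finite_set_measure E -> finite_set_measure F ->
  kernel_form E F = kernel_form F E.
Proof.
move=> fE fF; apply: EFin_inj.
rewrite (kernel_formE fE fF) (kernel_formE fF fE).
rewrite (Fubini (integrable_rect fE fF)).
apply: eq_integral => w _; apply: eq_integral => z _ /=.
rewrite !restrict_indicE k_sym !indicE; congr (_ * (nat_of_bool _)%:R)%:E.
by apply/idP/idP; rewrite !inE/= => -[].
Qed.

Lemma slice_le F z b : finite_set_measure F ->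
  (forall w, F w -> k (z, w) <= b) -> slice F z <= b * fine (mu F).
Proof.
move=> fF kb; have [mF finF] := fF; rewrite -(Rintegral_cst _ mF).
apply: le_Rintegral => //; first exact: integrable_slice.
apply: measurable_bounded_integrable => //.
by exists `|b|; split=> [|x bx w _]; [exact: num_real|exact: ltW].
Qed.

Lemma integrable_cst_on F b : finite_set_measure F ->
  mu.-integrable F (EFin \o (fun=> b)).
Proof.
move=> [mF finF]; apply: measurable_bounded_integrable => //.
by exists `|b|; split=> [|x bx w _]; [exact: num_real|exact: ltW].
Qed.

Lemma kernel_form_le E F b : finite_set_measure E -> finite_set_measure F ->
  (forall z, E z -> slice F z <= b) -> kernel_form E F <= b * fine (mu E).
Proof.
move=> fE fF kb; have [mE finE] := fE; rewrite -(Rintegral_cst _ mE).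
apply: le_Rintegral => //; first exact: integrable_slice_fun.
exact: integrable_cst_on.
Qed.

Lemma kernel_form_ge E F b : finite_set_measure E -> finite_set_measure F ->
  (forall z, E z -> b <= slice F z) -> b * fine (mu E) <= kernel_form E F.
Proof.
move=> fE fF kb; have [mE finE] := fE; rewrite -(Rintegral_cst _ mE).
apply: le_Rintegral => //; last exact: integrable_slice_fun.
exact: integrable_cst_on.
Qed.

Hypothesis k_pos : forall rho : T -> R, mu.-integrable setT (EFin \o rho) ->
  0 <= \int[mu]_z (\int[mu]_w (k (z, w) * rho z * rho w)).

(** Bilinear expansion of the positivity at the step function [rho], first in the inner and then in
    the outer variable. The sets may overlap, as the cylinder does with the sets [z_i U]. *)
Lemma kernel_form_pos N (a : 'I_N -> R) (E : 'I_N -> set T) :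
  (forall i, finite_set_measure (E i)) ->
  0 <= \sum_i \sum_j a i * a j * kernel_form (E i) (E j).
Proof.
move=> fE.
pose rho x := \sum_i a i * \1_(E i) x.
have irho : mu.-integrable setT (EFin \o rho).
  apply: (eq_integrable measurableT (fun x => (\sum_i (a i * \1_(E i) x)%:E)%E)).
    by move=> x _; rewrite /= sumEFin.
  apply: integrable_sum => // i _.
  have [mE _] := fE i.
  apply: (eq_integrable measurableT ((EFin \o (fun=> a i)) \_ (E i))).
    by move=> x _; rewrite /= restrict_EFin/= restrict_indicE.
  by apply/(integrable_mkcond _ mE); exact: integrable_cst_on.
have inner z : \int[mu]_w (k (z, w) * rho z * rho w) = \sum_j rho z * (a j * slice (E j) z).
  transitivity (\int[mu]_w \sum_j (rho z * a j) * ((fun w => k (z, w)) \_ (E j)) w).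
    apply: eq_Rintegral => w _; rewrite /rho mulr_sumr.
    by apply: eq_bigr => j _; rewrite restrict_indicE; ring.
  have ij j : mu.-integrable setT (EFin \o ((fun w => k (z, w)) \_ (E j))).
    rewrite -restrict_EFin; have [mE _] := fE j.
    by apply/(integrable_mkcond _ mE); exact: integrable_slice.
  rewrite Rintegral_sum//.
    apply: eq_bigr => j _; rewrite RintegralZl//.
    by rewrite -mulrA; congr (_ * (_ * _)); rewrite -Rintegral_mkcond.
  move=> j; apply: (eq_integrable measurableT
    (fun w => ((rho z * a j)%:E * (((fun w => k (z, w)) \_ (E j)) w)%:E)%E)).
    by move=> w _; rewrite /= EFinM.
  exact: integrableZl (ij j).
have := k_pos irho.
under eq_Rintegral do rewrite inner.
suff -> : \int[mu]_z (\sum_j rho z * (a j * slice (E j) z)) =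
  \sum_i \sum_j a i * a j * kernel_form (E i) (E j) by [].
transitivity (\int[mu]_z \sum_i \sum_j (a i * a j) * (slice (E j) \_ (E i)) z).
  apply: eq_Rintegral => z _; rewrite exchange_big/=; apply: eq_bigr => j _.
  by rewrite /rho mulr_suml; apply: eq_bigr => i _; rewrite restrict_indicE; ring.
have ij i j : mu.-integrable setT (EFin \o (slice (E j) \_ (E i))).
  rewrite -restrict_EFin; have [mE _] := fE i.
  by apply/(integrable_mkcond _ mE); exact: integrable_slice_fun.
have ija i j : mu.-integrable setT (EFin \o (fun z => (a i * a j) * (slice (E j) \_ (E i)) z)).
  apply: (eq_integrable measurableT
    (fun z => ((a i * a j)%:E * ((slice (E j) \_ (E i)) z)%:E)%E)).
    by move=> w _; rewrite /= EFinM.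
  exact: integrableZl (ij i j).
rewrite Rintegral_sum//.
  apply: eq_bigr => i _; rewrite Rintegral_sum//.
  apply: eq_bigr => j _; rewrite RintegralZl//; congr (_ * _).
  by rewrite -Rintegral_mkcond.
move=> i; apply: (eq_integrable measurableT
  (fun z => (\sum_j ((a i * a j) * (slice (E j) \_ (E i)) z)%:E)%E)).
  by move=> z _; rewrite /= sumEFin.
by apply: integrable_sum => // j _; exact: ija.
Qed.

End kernel_form.

(** * Neighbourhoods of the identity in the motion group *)

Section matrix_continuity.
Variable R : realType.

Lemma continuous_mx (T : topologicalType) m n (F : T -> 'M[R]_(m, n)) :
  (forall i j, continuous (fun x => F x i j)) -> continuous F.
Proof.
move=> cF x A [P FP PA]; rewrite /=.
have : \forall y \near x, forall i j, P i j (F y i j).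
  by apply: filter_forall => i; apply: filter_forall => j; exact/cF/FP.
by apply: filterS => y Py; exact: PA.
Qed.

Lemma continuous_sum (T : topologicalType) n (F : 'I_n -> T -> R) :
  (forall i, continuous (F i)) -> continuous (fun x => \sum_i F i x).
Proof.
by move=> cF; apply: continuous_big => // p; exact: add_continuous.
Qed.

Lemma continuous_mulr (T : topologicalType) (F G : T -> R) :
  continuous F -> continuous G -> continuous (fun x => F x * G x).
Proof. by move=> cF cG x; apply: continuousM; [exact: cF|exact: cG]. Qed.

Lemma continuous_entry (T : topologicalType) m n (F : T -> 'M[R]_(m, n)) i j :
  continuous F -> continuous (fun x => F x i j).
Proof.
move=> cF x.
apply: (@continuous_comp _ _ _ F (fun M : 'M[R]_(m, n) => M i j)); first exact: cF.
exact: coord_continuous.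
Qed.

Lemma continuous_mulmx (T : topologicalType) m n p
    (F : T -> 'M[R]_(m, n)) (G : T -> 'M[R]_(n, p)) :
  continuous F -> continuous G -> continuous (fun x => F x *m G x).
Proof.
move=> cF cG; apply: continuous_mx => i j.
rewrite (_ : (fun _ => _) = (fun x => \sum_k F x i k * G x k j)); last first.
  by apply/funext => x; rewrite mxE.
apply: continuous_sum => k; apply: continuous_mulr.
  exact: (continuous_entry cF).
exact: (continuous_entry cG).
Qed.

Lemma continuous_addmx (T : topologicalType) m n (F G : T -> 'M[R]_(m, n)) :
  continuous F -> continuous G -> continuous (fun x => F x + G x).
Proof. by move=> cF cG x; apply: cvgD; [exact: cF|exact: cG]. Qed.

Lemma continuous_trmx (T : topologicalType) m n (F : T -> 'M[R]_(m, n)) :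
  continuous F -> continuous (fun x => (F x)^T).
Proof.
move=> cF; apply: continuous_mx => i j.
rewrite (_ : (fun _ => _) = (fun x => F x j i)); last first.
  by apply/funext => x; rewrite mxE.
exact: (continuous_entry cF).
Qed.

End matrix_continuity.

Section motion_topology.
Variables (R : realType) (n : nat).

Lemma continuous_so_mx : continuous (@so_mx R n).
Proof. exact: initial_continuous. Qed.

Lemma continuous_SO (T : topologicalType) (F : T -> SO R n) :
  continuous (fun x => so_mx (F x)) -> continuous F.
Proof.
move=> /continuousP cF; apply/continuousP => _ [B oB <-].
by rewrite -comp_preimage; exact: cF.
Qed.

Lemma continuous_pair (T U V : topologicalType) (F : T -> U) (G : T -> V) :
  continuous F -> continuous G -> continuous (fun x => (F x, G x)).
Proof. by move=> cF cG x; apply: cvg_pair; [exact: cF|exact: cG]. Qed.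

(** With [g = z_j^-1 z_i] and [p = (u, v)] this is [(z_j v)^-1 (z_i u)], the argument of [f] when
    the two motions are perturbed independently on the right. *)
Lemma continuous_mot_conj (g : motion R n) : continuous
  (fun p : motion R n * motion R n => mot_mul (mot_inv p.2) (mot_mul g p.1)).
Proof.
have c1 : continuous (fun p : motion R n * motion R n => p.1.1).
  by move=> p; apply: continuous_comp; exact: cvg_fst.
have c2 : continuous (fun p : motion R n * motion R n => p.2.1).
  by move=> p; apply: continuous_comp; [exact: cvg_snd|exact: cvg_fst].
have s1 : continuous (fun p : motion R n * motion R n => so_mx p.1.2).
  move=> p; apply: (@continuous_comp _ _ _ (fun p : motion R n * motion R n => p.1.2)).
    by apply: continuous_comp; [exact: cvg_fst|exact: cvg_snd].
  exact: continuous_so_mx.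
have s2 : continuous (fun p : motion R n * motion R n => so_mx p.2.2).
  move=> p; apply: (@continuous_comp _ _ _ (fun p : motion R n * motion R n => p.2.2)).
    by apply: continuous_comp; exact: cvg_snd.
  exact: continuous_so_mx.
have cst m q (C : 'M[R]_(m, q)) : continuous (fun _ : motion R n * motion R n => C).
  by move=> p; exact: cvg_cst.
apply: continuous_pair; last first.
  apply: continuous_SO.
  rewrite (_ : (fun _ => _) = fun p : motion R n * motion R n =>
    (so_mx p.2.2)^T *m (so_mx g.2 *m so_mx p.1.2)).
    exact: (continuous_mulmx (continuous_trmx s2) (continuous_mulmx (cst _ _ _) s1)).
  by apply/funext => p; rewrite /= so_invmx.
rewrite (_ : (fun _ => _) = fun p : motion R n * motion R n =>
    (so_mx p.2.2)^T *m (g.1 - p.2.1 + so_mx g.2 *m p.1.1)).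
  apply: (continuous_mulmx (continuous_trmx s2)).
  apply: continuous_addmx; last exact: (continuous_mulmx (cst _ _ _) c1).
  by move=> p; apply: cvgB; [exact: cst|exact: c2].
apply/funext => p; rewrite /= !so_invmx !mulmxDr mulmxN.
by rewrite addrA (addrC (- _)).
Qed.

Lemma so_entry_le1 (A : SO R n) i j : `|so_mx A i j| <= 1.
Proof.
rewrite -(@ler_pXn2r _ 2)// ?nnegrE// expr1n -normrX ger0_norm ?sqr_ge0//.
have <- : \sum_k so_mx A k j ^+ 2 = 1.
  have /matrixP/(_ j j) := so_trmxK A; rewrite !mxE eqxx => A1.
  by rewrite -[RHS]A1; apply: eq_bigr => k _; rewrite mxE expr2.
by rewrite (bigD1 i)//= lerDl; apply: sumr_ge0 => k _; exact: sqr_ge0.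
Qed.

(* Countably many boxes of side d cover the group, so one of them has positive
   measure; translated by the inverse of one of its elements, it lies in O. *)
Lemma haar_open_gt0 (haar : probability (SO R n) R) (O : set (SO R n)) :
  is_haar haar -> open O -> O (so_one R n) -> (0 < haar O)%E.
Proof.
move=> haarP oO O1.
have [e e0 eO] : exists2 e : R, 0 < e & forall A : SO R n,
    (forall i j, `|so_mx A i j - (1%:M : 'M[R]_n) i j| < e) -> O A.
  move: (oO) (O1) => [V oV <-] V1.
  have /nbhs_ballP[e /= e0 eV] : nbhs (1%:M : 'M[R]_n) V by exact: open_nbhs_nbhs.
  exists e => // A Ae; apply: eV; split => // i j.
  by rewrite -ball_normE/= distrC; exact: Ae.
(* Two members of a box differ by less than [2 * d] in each entry, and a matrix product sums [n]
   such terms: [n * (2 * d) < e]. *)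
pose d := e / (2 * n.+1%:R).
have d0 : 0 < d by rewrite divr_gt0// mulr_gt0.
pose box (q : 'M[rat]_n) : set (SO R n) :=
  [set A | forall i j, `|so_mx A i j - ratr (q i j)| < d].
have mbox q : measurable (box q).
  have -> : box q = \bigcap_(ij in [set: 'I_n * 'I_n])
     ((fun A : SO R n => so_mx A ij.1 ij.2) @^-1` ball (ratr (q ij.1 ij.2) : R) d).
    apply/seteqP; split => [A bA [i j] _|A bA i j].
      by rewrite /preimage/= -ball_normE/= distrC; exact: bA.
    by have := bA (i, j) I; rewrite /preimage/= -ball_normE/= distrC.
  apply: fin_bigcap_measurable => [|[i j] _]; first exact: finite_finset.
  apply: preimage_measurable; last exact: measurable_ball.
  exact: (measurableT_comp (measurable_mx_entry i j) (@measurable_so_mx R n)).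
have [q bq] : exists q, (0 < haar (box q))%E.
  apply: contrapT => /forallNP bq0.
  pose F k := if @unpickle 'M[rat]_n k is Some q then box q else set0.
  have F0 k : haar (F k) = 0%E.
    rewrite /F; case: unpickle => [q|]; last by rewrite measure0.
    by apply/eqP; rewrite eq_le measure_ge0 andbT leNgt; apply/negP; exact: bq0.
  have mF k : measurable (F k) by rewrite /F; case: unpickle.
  have : (haar setT <= \sum_(k <oo) haar (F k))%E.
    apply: measure_sigma_subadditive => // A _.
    have /choice[q qA] (ij : 'I_n * 'I_n) : exists q : rat,
        `|so_mx A ij.1 ij.2 - ratr q| < d.
      have := @rat_in_itvoo R (so_mx A ij.1 ij.2 - d) (so_mx A ij.1 ij.2).
      rewrite ltrBlDr ltrDl => /(_ d0)[q /itvP qA]; exists q.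
      by rewrite distrC ltr_distl qA/= (lt_trans (y := so_mx A ij.1 ij.2)) ?qA// ltrDl.
    exists (pickle (\matrix_(i, j) q (i, j))) => //; rewrite /F pickleK => i j.
    by rewrite mxE; exact: (qA (i, j)).
  rewrite probability_setT eseries0; last by move=> k _ _; exact: F0.
  by rewrite lee_fin ler10.
have [A bA] : exists A, box q A.
  apply: contrapT => /forallNP bq0; move: bq; rewrite (_ : box q = set0) ?measure0 ?ltxx//.
  by apply/seteqP; split => // A /bq0.
have [_ pA] := preserves_haar A haarP.
rewrite (lt_le_trans bq)// -pA//; apply: le_measure; rewrite ?inE.
- by apply: preimage_measurable => //; have [] := preserves_haar A haarP.
- exact: measurable_SO_open.
move=> B /= bB; apply: eO => i j.
(* This is [B - 1 = A^T (A B - A)]: both [A B] and [A] lie in the box, and the entries of [A] are at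
   most 1 in absolute value. *)
have -> : so_mx B i j - (1%:M : 'M[R]_n) i j =
    \sum_k so_mx A k i * ((so_mx A *m so_mx B) k j - so_mx A k j).
  rewrite -(so_trmxK A) -{1}(mul1mx (so_mx B)) -(so_trmxK A) -mulmxA !mxE -sumrB.
  by apply: eq_bigr => k _; rewrite !mxE mulrBr.
apply: (@le_lt_trans _ _ (\sum_(k < n) (2 * d))).
  apply: (le_trans (ler_norm_sum _ _ _)); apply: ler_sum => k _.
  rewrite normrM -[leRHS]mul1r ler_pM// ?so_entry_le1//.
  rewrite (le_trans (ler_distD (ratr (q k j)) _ _))// mulr2n mulrDl mul1r.
  by apply: lerD; apply: ltW; [exact: bB|rewrite distrC; exact: bA].
rewrite sumr_const card_ord -[ltLHS]mulr_natl.
have n0 : n.+1%:R != 0 :> R by rewrite pnatr_eq0.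
rewrite (_ : _ * _ = e * (n%:R / n.+1%:R)); last first.
  by rewrite /d; move: n0; generalize (n.+1%:R : R) => m m0; field.
by rewrite gtr_pMr// ltr_pdivrMr// mul1r ltr_nat.
Qed.

(** The set must be measurable with positive finite measure, as its measure is divided by; the bound
    on translations keeps [z_i U] within distance 1 of the centre of [z_i]. *)
Lemma small_nbhs_mot_one (haar : probability (SO R n) R) (W : set (motion R n)) :
  is_haar haar -> nbhs (mot_one R n) W -> exists U : set (motion R n),
  [/\ measurable U, (0 < mot_measure haar U < +oo)%E, U `<=` W &
      forall u, U u -> enorm u.1 <= 1].
Proof.
move=> haarP [[V1 V2] /= [nV1 nV2] VW].
have /nbhs_ballP[e /= e0 eV] := nV1.
(* [e / 2] puts the closed cube inside the open ball of radius [e], and [n.+1%:R^-1] makes Euclidean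
   norms at most 1. *)
pose s := Num.min (e / 2) n.+1%:R^-1.
have s0 : 0 < s by rewrite lt_min divr_gt0//= invr_gt0.
exists (cube s `*` V2°).
have volE : mot_measure haar (cube s `*` V2°) = (((2 * s) ^+ n)%:E * haar V2°)%E.
  rewrite -lebesgue_cv_cube ?ltW//.
  apply: (product_measure1E (@lebesgue_cv_sf R n) haar (@measurable_cube R n s)).
  exact/measurable_SO_open/open_interior.
split.
- apply: measurableX; first exact: measurable_cube.
  exact/measurable_SO_open/open_interior.
- rewrite volE; apply/andP; split.
    rewrite mule_gt0//; first by rewrite lte_fin exprn_gt0// mulr_gt0.
    by apply: haar_open_gt0 => //; exact: open_interior.
  apply: lte_mul_pinfty => //; first by rewrite lee_fin exprn_ge0// mulr_ge0// ltW.
  rewrite (le_lt_trans (probability_le1 haar _)) ?ltry//.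
  exact/measurable_SO_open/open_interior.
- move=> [x A] [/= xs V2A]; apply: VW; split => /=; last exact: interior_subset.
  apply: eV; split => // i j; rewrite -ball_normE/= [j]ord1 mxE sub0r normrN.
  rewrite (le_lt_trans (xs i))// gt_min ltr_pdivrMr// mulr_natr mulr2n ltrDl e0 //.
- move=> [x A] [/= xs _]; rewrite (le_trans (enorm_cube xs))//.
  rewrite (@le_trans _ _ (n%:R * n.+1%:R^-1))//.
    by rewrite ler_wpM2l// ge_min lexx orbT.
  by rewrite ler_pdivrMr// mul1r ler_nat.
Qed.

(** Continuity at the pair of identities gives a neighbourhood for each [(i, j)], and finitely many
    of them can be intersected. *)
Lemma uniform_nbhs_mot_one (f : motion R n -> R) N (z : 'I_N -> motion R n) (eta : R) :
  continuous f -> 0 < eta ->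
  exists2 W, nbhs (mot_one R n) W & forall i j u v, W u -> W v ->
    f (mot_mul (mot_inv (mot_mul (z j) v)) (mot_mul (z i) u)) <=
    f (mot_mul (mot_inv (z j)) (z i)) + eta.
Proof.
move=> cf eta0.
pose P i j (p : motion R n * motion R n) : Prop :=
  f (mot_mul (mot_inv p.2) (mot_mul (mot_mul (mot_inv (z j)) (z i)) p.1)) <=
  f (mot_mul (mot_inv (z j)) (z i)) + eta.
have : nbhs ((mot_one R n, mot_one R n) : motion R n * motion R n) (fun p => forall i j, P i j p).
  apply: (@filter_forall _ _ (fun i p => forall j, P i j p) _ (nbhs_filter _)) => i.
  apply: (@filter_forall _ _ (P i) _ (nbhs_filter _)) => j; rewrite /P.
  set g := mot_mul (mot_inv (z j)) (z i).
  have gE : mot_mul (mot_inv (mot_one R n)) (mot_mul g (mot_one R n)) = g.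
    by rewrite mot_mulr1 -{1}(mot_mul1 g) mot_mulK.
  have cfg : continuous (f \o
      (fun p : motion R n * motion R n => mot_mul (mot_inv p.2) (mot_mul g p.1))).
    by move=> p; apply: continuous_comp; [exact: continuous_mot_conj|exact: cf].
  have /cvgrPdist_le/(_ _ eta0) := cfg (mot_one R n, mot_one R n).
  by apply: filterS => p /=; rewrite gE distrC => /ler_normlW; rewrite lerBlDl.
move=> [[W1 W2] /= [nW1 nW2] W12]; exists (W1 `&` W2); first exact: filterI.
move=> i j u v [W1u _] [_ W2v].
have := W12 (u, v) (conj W1u W2v) i j.
by rewrite /P /= mot_invM -!mot_mulA.
Qed.

End motion_topology.

(** * Functions of positive type on the motion group *)

Section Rintegral_more.
Context d (T : measurableType d) (R : realType).
Variable mu : {measure set T -> \bar R}.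

Lemma preserves_Rintegral phi (g : T -> R) :
  preserves mu phi -> measurable_fun setT g ->
  \int[mu]_x g (phi x) = \int[mu]_x g x.
Proof.
move=> pphi mg; congr fine.
have mEg : measurable_fun setT (EFin \o g) by exact/measurable_EFinP.
rewrite integralE [RHS]integralE; congr (_ - _)%E.
  rewrite -[RHS](preserves_integral pphi (measurable_funepos mEg)); last first.
    by move=> x; exact: funepos_ge0.
  by apply: eq_integral => x _; rewrite !funeposE.
rewrite -[RHS](preserves_integral pphi (measurable_funeneg mEg)); last first.
  by move=> x; exact: funeneg_ge0.
by apply: eq_integral => x _; rewrite !funenegE.
Qed.

Lemma Rintegral_setC (D : set T) (g : T -> R) : measurable D ->
  mu.-integrable setT (EFin \o g) ->
  \int[mu]_x g x = \int[mu]_(x in D) g x + \int[mu]_(x in ~` D) g x.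
Proof.
move=> mD ig; rewrite -{1}(setUv D) Rintegral_setU//.
- exact: measurableC.
- by rewrite setUv.
- by apply/disj_setPS => x [].
Qed.

Lemma subset_Rintegral (A B : set T) (g : T -> R) :
  measurable A -> measurable B -> mu.-integrable B (EFin \o g) ->
  (forall x, 0 <= g x) -> A `<=` B ->
  \int[mu]_(x in A) g x <= \int[mu]_(x in B) g x.
Proof.
move=> mA mB ig g0 AB.
have iA : mu.-integrable A (EFin \o g) by exact: integrableS ig.
apply: fine_le.
- exact: integrable_fin_num iA.
- exact: integrable_fin_num ig.
- apply: ge0_subset_integral => //; first exact: measurable_int ig.
  by move=> x _; rewrite lee_fin.
Qed.

End Rintegral_more.

Section cylinder.
Variables (R : realType) (n : nat).

Definition cylinder (p : 'cV[R]_n) S : set (motion R n) :=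
  euclidean_ball p S `*` setT.

Lemma measurable_cylinder p S : measurable (cylinder p S).
Proof. by apply: measurableX => //; exact: measurable_euclidean_ball. Qed.

Lemma cylinderE p S z : cylinder p S z <-> enorm (z.1 - p) <= S.
Proof. by rewrite /cylinder euclidean_ballE; split => [[]|]. Qed.

Lemma measure_cylinder (haar : probability (SO R n) R) p S : 0 < S ->
  mot_measure haar (cylinder p S) = (S ^+ n * ball_const R n)%:E.
Proof.
move=> S0; rewrite -(vol_euclidean_ball p S0).
transitivity (lebesgue_cv R n (euclidean_ball p S) * haar setT)%E.
  exact: (product_measure1E (@lebesgue_cv_sf R n) haar
    (@measurable_euclidean_ball R n p S) measurableT).
by rewrite probability_setT mule1.
Qed.

Lemma mot_measure_sigma_finite (haar : probability (SO R n) R) :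
  sigma_finite setT (mot_measure haar).
Proof.
exists (fun k => cylinder 0 k.+1%:R).
  apply/seteqP; split => // z _; exists (Num.Def.truncn (enorm (z.1 - 0))) => //.
  by apply/cylinderE; exact: ltW (truncnS_gt _).
move=> k; split; first exact: measurable_cylinder.
by rewrite measure_cylinder// ltry.
Qed.

(** A second name for [mot_measure], carrying the sigma-finite structure that Fubini requires. *)
Definition mot_sf (haar : probability (SO R n) R) : set (motion R n) -> \bar R :=
  mot_measure haar.

HB.instance Definition _ (haar : probability (SO R n) R) := isMeasure.Build _ _ _
  (mot_sf haar) (measure0 (mot_measure haar)) (measure_ge0 (mot_measure haar))
  (@measure_semi_sigma_additive _ _ _ (mot_measure haar)).

HB.instance Definition _ (haar : probability (SO R n) R) :=
  Measure_isSigmaFinite.Build _ _ _ (mot_sf haar) (mot_measure_sigma_finite haar).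

End cylinder.

Section positive_type.
Variables (R : realType) (n : nat) (haar : probability (SO R n) R).
Hypothesis haarP : is_haar haar.
Local Notation mu := (mot_sf haar).
Variable f : motion R n -> R.
Hypothesis f_L1 : mu.-integrable setT (EFin \o f).
Hypothesis f_pt : positive_type haar (fun z => (f z)%:C%C).

Lemma measurable_L1 : measurable_fun setT f.
Proof. by apply/measurable_EFinP; exact: measurable_int f_L1. Qed.

Lemma positive_type_inv z : f (mot_inv z) = f z.
Proof.
have [/(_ z) + _] := f_pt; rewrite conj_Creal; last by rewrite complex_real.
by case.
Qed.

Definition mot_kernel (p : motion R n * motion R n) : R :=
  f (mot_mul (mot_inv p.2) p.1).

Lemma measurable_mot_kernel : measurable_fun setT mot_kernel.
Proof. exact: (measurableT_comp measurable_L1 (@measurable_mot_div R n)). Qed.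

Lemma mot_kernel_sym z w : mot_kernel (z, w) = mot_kernel (w, z).
Proof. by rewrite /mot_kernel/= -positive_type_inv mot_invM mot_invK. Qed.

(** Real test densities are enough for the bound. For them every integrand is real, so the imaginary
    parts integrate to 0 and the order on [R[i]] reduces to that of the real parts. *)
Lemma mot_kernel_pos (rho : motion R n -> R) : mu.-integrable setT (EFin \o rho) ->
  0 <= \int[mu]_z (\int[mu]_w (mot_kernel (z, w) * rho z * rho w)).
Proof.
move=> irho; have [_ /(_ (fun z => (rho z)%:C%C))] := f_pt.
have i0 : cintegrable (mot_measure haar) (fun z => (rho z)%:C%C).
  by split => //=; exact: integrable0.
move=> /(_ i0).
have inner z : cintegral (mot_measure haar) (fun w =>
    (f (mot_mul (mot_inv w) z))%:C * (rho z)%:C * ((rho w)%:C)^*)%C =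
    (\int[mu]_w (mot_kernel (z, w) * rho z * rho w))%:C%C.
  have E w : ((f (mot_mul (mot_inv w) z))%:C * (rho z)%:C * ((rho w)%:C)^*)%C =
      (mot_kernel (z, w) * rho z * rho w)%:C%C.
    by rewrite conj_Creal ?complex_real// -!rmorphM.
  rewrite /cintegral; congr (_ +i* _)%C.
    by apply: eq_Rintegral => w _; rewrite E.
  under eq_Rintegral do rewrite E.
  by rewrite Rintegral_cst// mul0r.
by rewrite (funext inner) /cintegral lecE/= => /andP[_].
Qed.

Definition mass : R := \int[mu]_z f z.
Definition l1_norm : R := \int[mu]_z `|f z|.

Lemma preserves_mot z : preserves mu (mot_mul z).
Proof. exact: preserves_mot_mul. Qed.

Lemma mot_mul_preimage_measurable z B :
  measurable B -> measurable [set u : motion R n | B (mot_mul z u)].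
Proof. by move=> mB; exact: (preimage_measurable (preserves_mot z).1 mB). Qed.

(* The substitution [w = z u], after [f (w^-1 z) = f (z^-1 w)]. *)
Lemma mot_sliceE B z : measurable B ->
  slice mu mot_kernel B z = \int[mu]_(u in [set u | B (mot_mul z u)]) f u.
Proof.
move=> mB; rewrite /slice [LHS]Rintegral_mkcond [RHS]Rintegral_mkcond.
have mg : measurable_fun setT (f \_ [set u | B (mot_mul z u)]).
  apply/(measurable_restrictT f (mot_mul_preimage_measurable z mB)).
  exact: measurable_funTS measurable_L1.
rewrite -[RHS](preserves_Rintegral (preserves_mot (mot_inv z)) mg).
apply: eq_Rintegral => w _; rewrite !patchE /= mot_kernel_sym /mot_kernel/=.
by rewrite (_ : _ \in [set u | _] = (w \in B))//; apply/idP/idP; rewrite !inE/= mot_mulKV.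
Qed.

Lemma integrable_f (D : set (motion R n)) : measurable D ->
  mu.-integrable D (EFin \o f).
Proof. by move=> mD; apply: integrableS f_L1. Qed.

Lemma integrable_normf (D : set (motion R n)) : measurable D ->
  mu.-integrable D (EFin \o (fun u => `|f u|)).
Proof. by move=> mD; exact: integrable_norm (integrable_f mD). Qed.

(** A crude bound valid at every [z]; it serves for points close to the boundary of the cylinder,
    where the slice need not be near [mass]. *)
Lemma mot_slice_le_norm B z : measurable B -> slice mu mot_kernel B z <= l1_norm.
Proof.
move=> mB; have mD := mot_mul_preimage_measurable z mB.
rewrite mot_sliceE// (le_trans (ler_norm _))//.
rewrite (le_trans (le_normr_Rintegral mD (integrable_f mD)))//.
by apply: subset_Rintegral => //; exact: integrable_normf.
Qed.

Definition tail L : R := \int[mu]_(u in [set u : motion R n | L < enorm u.1]) `|f u|.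

Lemma measurable_enorm1 : measurable_fun setT (fun u : motion R n => enorm u.1).
Proof. exact: (measurableT_comp (@measurable_enorm R n) measurable_fst). Qed.

Lemma measurable_far L : measurable [set u : motion R n | L < enorm u.1].
Proof.
rewrite (_ : [set _ | _] = (fun u : motion R n => enorm u.1) @^-1` `]L, +oo[%classic).
  by apply: preimage_measurable => //; exact: measurable_enorm1.
by apply/seteqP; split => u /=; rewrite in_itv/= andbT.
Qed.

(** After [mot_sliceE] the difference is the integral of [f] over those [u] for which [mot_mul z u]
    leaves the cylinder. Rotations preserve [enorm], so such a [u] has a translation part longer
    than [L]. *)
Lemma mot_slice_near p S L z : enorm (z.1 - p) + L <= S ->
  `|mass - slice mu mot_kernel (cylinder p S) z| <= tail L.
Proof.
move=> zS; have mB := measurable_cylinder p S.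
have mD := mot_mul_preimage_measurable z mB.
rewrite mot_sliceE// /mass (Rintegral_setC mD f_L1) addrC addKr.
have mC := measurableC mD.
rewrite (le_trans (le_normr_Rintegral mC (integrable_f mC)))//.
apply: subset_Rintegral => //; [exact: measurable_far|exact: integrable_normf (measurable_far L)|].
move=> u /=; apply: contra_notT; rewrite -leNgt => uL.
apply/cylinderE => /=; rewrite addrAC; apply: le_trans (enormD _ _) _.
by rewrite enorm_SO (le_trans _ zS)// lerD2l.
Qed.

(** Monotone convergence of the integrals of [|f|] over the sets [enorm u.1 <= m], whose complements
    carry the tails. *)
Lemma tail_small eps : 0 < eps -> exists2 L, 0 < L & tail L <= eps.
Proof.
move=> eps0.
pose F (m : nat) := [set u : motion R n | enorm u.1 <= m%:R].
have FE m : F m = ~` [set u : motion R n | m%:R < enorm u.1].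
  rewrite /F; apply/seteqP; split => u /=; first by rewrite leNgt => /negP.
  by move/negP; rewrite -leNgt.
have mF m : measurable (F m) by rewrite FE; apply: measurableC; exact: measurable_far.
have bigF : \bigcup_m F m = setT.
  apply/seteqP; split => // u _; exists (Num.Def.truncn (enorm u.1)).+1 => //.
  exact: ltW (truncnS_gt _).
have iabs := integrable_normf measurableT.
have nd : nondecreasing_seq F.
  move=> a b ab; apply/subsetPset => u /= /le_trans; apply.
  by rewrite ler_nat.
have mabs m : measurable_fun (F m) (EFin \o (fun u => `|f u|)).
  by apply: measurable_funTS; exact: measurable_int iabs.
have := ge0_nondecreasing_set_cvg_integral (mu := mu) nd mF mabs.
move=> /(_ (fun _ _ _ => normr_ge0 _)); rewrite bigF => cv.
have fineN : l1_norm%:E = (\int[mu]_x (`|f x|%R)%:E)%E.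
  by rewrite fineK//; exact: integrable_fin_num iabs.
have {}cv : (\int[mu]_(x in F m) (`|f x|%R)%:E)%E @[m --> \oo] --> l1_norm%:E.
  by rewrite fineN; exact: cv.
have {}cv : (\int[mu]_(u in F m) `|f u|) @[m --> \oo] --> l1_norm.
  exact: (fine_cvg cv).
move/cvgrPdist_le : cv => /(_ _ eps0)[m _ mP].
(* The successor guarantees a positive radius. *)
exists m.+1%:R => //; have := mP m.+1 (leqnSn m).
have -> : l1_norm = \int[mu]_(u in F m.+1) `|f u| + tail m.+1%:R.
  by rewrite /l1_norm (Rintegral_setC (mF m.+1) iabs) /tail FE setCK.
by rewrite addrC addKr => /(le_trans (ler_norm _)).
Qed.

End positive_type.

(** * The positive-type inequality for a finite configuration of motions *)

Section core.
Variables (R : realType) (n : nat) (haar : probability (SO R n) R).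
Hypothesis haarP : is_haar haar.
Local Notation mu := (mot_sf haar).
Variable f : motion R n -> R.
Hypothesis f_L1 : mu.-integrable setT (EFin \o f).
Hypothesis f_bounded : exists M : R, forall z, `|f z| <= M.
Hypothesis f_continuous : continuous f.
Hypothesis f_pt : positive_type haar (fun z => (f z)%:C%C).

Local Notation ker := (mot_kernel f).
Local Notation q := (kernel_form mu ker).
Local Notation lam := (mass haar f).

Definition ball_vol (s : R) : R := s ^+ n * ball_const R n.

Lemma finite_cylinder p s : 0 < s -> finite_set_measure mu (cylinder p s).
Proof.
move=> s0; split; first exact: measurable_cylinder.
by rewrite [ltLHS](measure_cylinder haar p s0) ltry.
Qed.

Lemma fine_cylinder (p : 'cV[R]_n) s : 0 < s -> fine (mu (cylinder p s)) = ball_vol s.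
Proof. by move=> s0; rewrite [X in fine X](measure_cylinder haar p s0). Qed.

Lemma bounded_ker : exists M : R, forall p, `|ker p| <= M.
Proof. by have [M fM] := f_bounded; exists M => p; exact: fM. Qed.

Section configuration.
Variables (p : 'cV[R]_n) (r L eps : R).
Hypotheses (r0 : 0 < r) (L0 : 0 < L) (tail_eps : tail haar f L <= eps).
(** Centres lie within [r], the sets [z_i U] within [r + 1], and the last [L] puts every point of
    these sets at depth [L] in the cylinder. *)
Let S := r + 1 + L.
Let B := cylinder p S.
Let r1 : 0 < r + 1. Proof. by rewrite addr_gt0. Qed.
Let S0 : 0 < S. Proof. by rewrite addr_gt0. Qed.

(* Bounds [q B B]: the slice at w is within eps of the integral of f when w is at
   depth L inside the cylinder B, and at most the L1 norm of f otherwise. *)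
Definition deep_bound : R :=
  ball_vol (r + 1) * (lam + eps) + (ball_vol (r + 1 + L) - ball_vol (r + 1)) * l1_norm haar f.

Lemma slice_deep w : enorm (w.1 - p) <= r + 1 -> `|lam - slice mu ker B w| <= eps.
Proof.
by move=> wr; apply: le_trans tail_eps; apply: mot_slice_near => //; rewrite /S lerD2r.
Qed.

Lemma kernel_form_ball : q B B <= deep_bound.
Proof.
have [M kM] := bounded_ker.
have mk := measurable_mot_kernel f_L1.
pose B1 := cylinder p (r + 1).
have fB := finite_cylinder p S0; have fB1 := finite_cylinder p r1.
have [mB finB] := fB; have [mB1 finB1] := fB1.
have B1B : B1 `<=` B.
  by move=> z /cylinderE zr; apply/cylinderE/(le_trans zr); rewrite lerDl ltW.
have mD : measurable (B `\` B1) by exact: measurableD.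
have fD : finite_set_measure mu (B `\` B1).
  by split=> //; apply: le_lt_trans finB; apply: le_measure; rewrite ?inE//; exact: subDsetl.
have -> : q B B = q B1 B + q (B `\` B1) B.
  rewrite /kernel_form -{1}(setDUK B1B) Rintegral_setU//.
  - by rewrite setDUK//; exact: (integrable_slice_fun mk kM fB fB).
  - by apply/disj_setPS => x [? []].
have muD : fine (mu (B `\` B1)) = ball_vol S - ball_vol (r + 1).
  have -> : mu (B `\` B1) = (mu B - mu B1)%E.
    rewrite (measureD (mu := mu) mB mB1 finB).
    by congr (_ - mu _)%E; apply: setIidr.
  rewrite -(fine_cylinder p S0) -(fine_cylinder p r1) fineB//.
    by rewrite ge0_fin_numE.
  by rewrite ge0_fin_numE.
rewrite /deep_bound; apply: lerD.
  rewrite mulrC -(fine_cylinder p r1); apply: (kernel_form_le mk kM fB1 fB).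
  by move=> w /cylinderE /slice_deep; rewrite ler_distlC => /andP[].
rewrite mulrC -muD; apply: (kernel_form_le mk kM fD fB).
by move=> z _; exact: mot_slice_le_norm.
Qed.

Variables (N : nat) (z : 'I_N -> motion R n).
Hypothesis z_near : forall i, enorm ((z i).1 - p) <= r.
Hypothesis z_sep : forall i j, i != j -> f (mot_mul (mot_inv (z j)) (z i)) <= 0.

(** Among the [N ^ 2] pairs, the diagonal contributes [N] times [f (mot_one R n)], the others a
    nonpositive amount, and each pair pays at most [eta] for the smearing by [U]. *)
Lemma core_inequality_eta eta c : 0 < eta -> 0 <= c ->
  0 <= N%:R * f (mot_one R n) + N%:R ^+ 2 * eta - 2 * c * N%:R * (lam - eps)
       + c ^+ 2 * deep_bound.
Proof.
move=> eta0 c0.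
have [W nW fW] := uniform_nbhs_mot_one z f_continuous eta0.
have [U [mU /andP[U0 Ufin] UW U1]] := small_nbhs_mot_one haarP nW.
pose m := fine (mu U).
have m0 : 0 < m by apply: fine_gt0; apply/andP.
pose E i := [set w | U (mot_mul (mot_inv (z i)) w)].
have mE i : measurable (E i) := preimage_measurable (preserves_mot haarP (mot_inv (z i))).1 mU.
have muE i : mu (E i) = mu U := (preserves_mot haarP (mot_inv (z i))).2 U mU.
have fE i : finite_set_measure mu (E i) by split; [exact: mE|rewrite [ltLHS](muE i)].
have fB := finite_cylinder p S0.
have [M kM] := bounded_ker.
have mk := measurable_mot_kernel f_L1.
(* Index [ord0] stands for the cylinder, with weight [- c]; the other [N] indices stand for the sets
   [z_i U], each normalised to mass 1. *)
pose a (i : 'I_N.+1) : R := if unlift ord0 i is Some _ then m^-1 else - c.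
pose F (i : 'I_N.+1) := if unlift ord0 i is Some j then E j else B.
have fF i : finite_set_measure mu (F i).
  by rewrite /F; case: (unlift _ _) => [j|]; [exact: fE|exact: fB].
have := kernel_form_pos mk kM (mot_kernel_pos f_pt) a fF.
have -> : \sum_i \sum_j a i * a j * q (F i) (F j) =
    c ^+ 2 * q B B - 2 * c * (m^-1 * \sum_i q (E i) B) +
    m^-1 ^+ 2 * \sum_i \sum_j q (E i) (E j).
  rewrite big_ord_recl big_ord_recl /a /F unlift_none.
  under eq_bigr do rewrite liftK.
  under [X in _ + X]eq_bigr do [rewrite big_ord_recl unlift_none liftK;
    under eq_bigr do rewrite liftK].
  rewrite big_split/= !mulr_sumr.
  (* By symmetry the terms with the cylinder in the first or in the second slot agree, whence the
     factor 2. *)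
  have -> : \sum_(i < N) - c * m^-1 * q B (E i) = \sum_(i < N) - c * m^-1 * q (E i) B.
    apply: eq_bigr => i _; congr (_ * _).
    exact: (kernel_form_sym mk kM (mot_kernel_sym f_pt) fB (fE i)).
  under [X in _ = _ + X]eq_bigr do rewrite mulr_sumr.
  under [X in _ = _ + X]eq_bigr do under eq_bigr do rewrite expr2.
  rewrite !addrA; congr (_ + _).
  rewrite mulrNN -expr2 -addrA; congr (_ + _).
  rewrite -big_split/= -sumrN; apply: eq_bigr => i _; ring.
have qEB : N%:R * (lam - eps) <= m^-1 * \sum_i q (E i) B.
  rewrite mulr_sumr -[N in N%:R](card_ord N) mulr_natl -sumr_const.
  apply: ler_sum => i _; rewrite ler_pdivlMl// mulrC -{1}/m.
  rewrite /m -(muE i); apply: (kernel_form_ge mk kM (fE i) fB) => w Ew.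
  have /slice_deep : enorm (w.1 - p) <= r + 1.
    have [u Uu <-] : exists2 u, U u & mot_mul (z i) u = w.
      by exists (mot_mul (mot_inv (z i)) w); [exact: Ew|exact: mot_mulKV].
    rewrite /= addrAC (le_trans (enormD _ _))// lerD//.
    by rewrite enorm_SO; exact: U1.
  by rewrite ler_distlC => /andP[+ _].
have qEE : m^-1 ^+ 2 * \sum_i \sum_j q (E i) (E j) <=
    N%:R * f (mot_one R n) + N%:R ^+ 2 * eta.
  rewrite mulr_sumr.
  have -> : N%:R * f (mot_one R n) + N%:R ^+ 2 * eta =
      \sum_(i < N) (f (mot_one R n) + \sum_(j < N) eta).
    rewrite !sumr_const card_ord -(mulr_natl eta) -[RHS]mulr_natl.
    by move: (f _) => f1; ring.
  apply: ler_sum => i _; rewrite mulr_sumr.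
  apply: (@le_trans _ _ (\sum_j (f (mot_mul (mot_inv (z j)) (z i)) + eta))).
    apply: ler_sum => j _; rewrite exprVn ler_pdivrMl ?exprn_gt0// mulrC expr2 mulrA.
    have mj k : fine (mu (E k)) = m := congr1 fine (muE k).
    rewrite -{1}(mj j) -(mj i).
    apply: (kernel_form_le mk kM (fE i) (fE j)) => w Ew.
    apply: (slice_le mk kM (fE j)) => v Ev.
    rewrite /mot_kernel/= -(mot_mulKV (z i) w) -(mot_mulKV (z j) v).
    by apply: fW; apply: UW.
  (* The term [j = i] is the value at the identity; the remaining ones are nonpositive by
     [z_sep]. *)
  rewrite big_split/= lerD2r (bigD1 i)//= mot_mulV gerDl.
  by apply: sumr_le0 => j ji; apply: z_sep; rewrite eq_sym.
have qBB := kernel_form_ball.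
move=> H; apply: (le_trans H).
have h1 : c ^+ 2 * q B B <= c ^+ 2 * deep_bound by rewrite ler_wpM2l// sqr_ge0.
have h2 : 2 * c * (N%:R * (lam - eps)) <= 2 * c * (m^-1 * \sum_i q (E i) B).
  by rewrite ler_wpM2l// mulr_ge0.
move: h1 h2 qEE; rewrite !mulrA; lra.
Qed.

End configuration.
End core.

(** * Counting separated motions *)

Section count.
Variables (R : realType) (n : nat) (haar : probability (SO R n) R).
Hypothesis haarP : is_haar haar.
Local Notation mu := (mot_sf haar).
Variable f : motion R n -> R.
Hypothesis f_L1 : mu.-integrable setT (EFin \o f).
Hypothesis f_bounded : exists M : R, forall z, `|f z| <= M.
Hypothesis f_continuous : continuous f.
Hypothesis f_pt : positive_type haar (fun z => (f z)%:C%C).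
Local Notation lam := (mass haar f).
Local Notation f1 := (f (mot_one R n)).

(** All that the counting argument retains of the geometry: hypothesis (ii) on [f] enters only
    through this sign condition. *)
Definition separated N (z : 'I_N -> motion R n) : Prop :=
  forall i j, i != j -> f (mot_mul (mot_inv (z j)) (z i)) <= 0.

Lemma ball_vol_gt0 (s : R) : 0 < s -> 0 < ball_vol n s.
Proof. by move=> s0; rewrite mulr_gt0 ?exprn_gt0// ball_const_gt0. Qed.

Lemma core_inequality p r L eps N (z : 'I_N -> motion R n) c :
  0 < r -> 0 < L -> tail haar f L <= eps ->
  (forall i, enorm ((z i).1 - p) <= r) -> separated z -> 0 <= c ->
  0 <= N%:R * f1 - 2 * c * N%:R * (lam - eps) + c ^+ 2 * deep_bound haar f r L eps.
Proof.
move=> r0 L0 tL zr zs c0; apply/ler_addgt0Pr => e e0.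
(* Adding 1 to the denominator keeps it positive when [N = 0]. *)
pose eta := e / (N%:R ^+ 2 + 1).
have N2 : 0 < N%:R ^+ 2 + 1 :> R by rewrite ltr_wpDl// sqr_ge0.
have eta0 : 0 < eta by rewrite divr_gt0.
have := core_inequality_eta haarP f_L1 f_bounded f_continuous f_pt r0 L0 tL zr zs eta0 c0.
have : N%:R ^+ 2 * eta <= e.
  by rewrite /eta mulrA ler_pdivrMr// mulrC ler_wpM2l ?(ltW e0)// lerDl.
by lra.
Qed.

(** At [c = N / V] the quadratic factors as [N / V] times [f1 * V - N * (lam - 4 * eps)]: two of the
    four [eps] come from the cross term and two from the bound on [deep_bound]. Positivity of [N]
    allows the first factor to be cancelled. *)
Lemma count_bound_pos p r L eps N (z : 'I_N -> motion R n) :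
  0 < r -> 0 < L -> tail haar f L <= eps ->
  deep_bound haar f r L eps <= ball_vol n (r + 1 + L) * (lam + 2 * eps) ->
  (forall i, enorm ((z i).1 - p) <= r) -> separated z -> (0 < N)%N ->
  N%:R * (lam - 4 * eps) <= f1 * ball_vol n (r + 1 + L).
Proof.
move=> r0 L0 tL; set V := ball_vol n (r + 1 + L); set D := deep_bound _ _ _ _ _.
move=> DV zr zs N0.
have V0 : 0 < V by apply: ball_vol_gt0; rewrite !addr_gt0.
have N0' : 0 < N%:R :> R by rewrite ltr0n.
have c0 : 0 <= N%:R / V :> R by rewrite divr_ge0 ?ltW.
have := core_inequality r0 L0 tL zr zs c0; rewrite -/D.
have : (N%:R / V) ^+ 2 * D <= (N%:R / V) ^+ 2 * (V * (lam + 2 * eps)).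
  by rewrite ler_wpM2l// sqr_ge0.
move=> h1 h2; have := le_trans h2 (lerD (lexx _) h1).
have -> : N%:R * f1 - 2 * (N%:R / V) * N%:R * (lam - eps) +
    (N%:R / V) ^+ 2 * (V * (lam + 2 * eps)) =
    (N%:R / V) * (f1 * V - N%:R * (lam - 4 * eps)).
  by move: (f1) => a; field; rewrite gt_eqF.
by rewrite pmulr_rge0 ?divr_gt0// subr_ge0.
Qed.

Lemma count_bound p r L eps N (z : 'I_N -> motion R n) :
  0 < r -> 0 < L -> tail haar f L <= eps -> 4 * eps <= lam ->
  deep_bound haar f r L eps <= ball_vol n (r + 1 + L) * (lam + 2 * eps) ->
  (forall i, enorm ((z i).1 - p) <= r) -> separated z ->
  N%:R * (lam - 4 * eps) <= f1 * ball_vol n (r + 1 + L).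
Proof.
move=> r0 L0 tL el DV zr zs.
have [N0|] := posnP N; last exact: count_bound_pos.
rewrite N0 mul0r.
(* For [N = 0] the right side must be nonnegative; this is read off from the bound for the single
   motion [(p, so_one R n)]. *)
apply: (@le_trans _ _ (1%:R * (lam - 4 * eps))); first by rewrite mul1r subr_ge0.
apply: (@count_bound_pos p r L eps 1 (fun=> (p, so_one R n))) => //.
  by move=> _; rewrite subrr enorm0 ltW.
by move=> i j; rewrite (ord1 i) (ord1 j) eqxx.
Qed.

(** The sign of [f1] is needed when the volume of the large cylinder is later replaced by the upper
    bound [(1 + t) * ball_vol n r]. *)
Lemma mot_one_ge0 eps L : 0 < L -> tail haar f L <= eps -> 4 * eps < lam ->
  (exists2 r, 0 < r &
   deep_bound haar f r L eps <= ball_vol n (r + 1 + L) * (lam + 2 * eps)) ->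
  0 <= f1.
Proof.
move=> L0 tL el [r r0 DV].
have := @count_bound 0 r L eps 1 (fun=> mot_one R n) r0 L0 tL (ltW el) DV.
have V0 : 0 < ball_vol n (r + 1 + L) by apply: ball_vol_gt0; rewrite !addr_gt0.
move=> H; have {}H : 1%:R * (lam - 4 * eps) <= f1 * ball_vol n (r + 1 + L).
  apply: H => [i|i j]; first by rewrite /= subrr enorm0 ltW.
  by rewrite (ord1 i) (ord1 j) eqxx.
rewrite -(pmulr_lge0 _ V0); apply: le_trans H.
by rewrite mul1r subr_ge0 ltW.
Qed.

(** The quotient of the volumes is [(1 + C / r) ^+ n], and the power function is continuous at 1. *)
Lemma ball_vol_ratio (C eta : R) : 0 < eta -> exists2 r0, 0 < r0 &
  forall r, r0 <= r -> ball_vol n (r + C) <= (1 + eta) * ball_vol n r.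
Proof.
move=> eta0.
have /cvgrPdist_le/(_ _ eta0) := @exprn_continuous R n (1 : R).
rewrite expr1n => /nbhs_ballP[d /= d0 dP].
(* This makes the absolute value of [C / r] strictly less than [d]; the 1 keeps the radius positive
   when [C = 0]. *)
exists ((`|C| + 1) / d) => [|r rd]; first by rewrite divr_gt0// ltr_wpDl.
have r0 : 0 < r by apply: lt_le_trans rd; rewrite divr_gt0// ltr_wpDl.
have rC : ball (1 : R) d (1 + C / r).
  rewrite -ball_normE/= opprD addNKr normrN normrM normfV (gtr0_norm r0).
  by rewrite ltr_pdivrMr// mulrC -ltr_pdivrMr// (lt_le_trans _ rd)// ltr_pM2r ?invr_gt0// ltrDl.
have := dP _ rC; rewrite distrC => /ler_normlW; rewrite lerBlDl => H.
rewrite /ball_vol mulrA ler_pM2r ?ball_const_gt0//.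
have -> : r + C = r * (1 + C / r) by field; rewrite gt_eqF.
by rewrite exprMn mulrC ler_wpM2r// exprn_ge0// ltW.
Qed.

Lemma ball_vol_le (s t : R) : 0 <= s -> s <= t -> ball_vol n s <= ball_vol n t.
Proof.
move=> s0 st; rewrite ler_pM2r ?ball_const_gt0//.
by apply: lerXn2r => //; rewrite nnegrE// (le_trans s0).
Qed.

(* [T <= V(S)(lam + 2 eps)] once [V(S) - V(r + 1)] is a small fraction of [V(r)]. *)
Lemma eventual_count_bound (D t : R) : 0 < lam -> 0 <= D -> 0 < t < 1 ->
  exists2 r0, 0 < r0 & forall r, r0 <= r ->
    0 <= f1 /\
    forall p N (z : 'I_N -> motion R n),
    (forall i, enorm ((z i).1 - p) <= r + D) -> separated z ->
    N%:R * (lam * (1 - t)) <= f1 * ((1 + t) * ball_vol n r).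
Proof.
move=> lam0 D0 /andP[t0 t1].
(* Chosen so that the loss [4 * eps] of [count_bound] is exactly [lam * t]. *)
pose eps := lam * t / 4.
have eps0 : 0 < eps by rewrite divr_gt0// mulr_gt0.
have [L L0 tL] := tail_small f_L1 eps0.
have M0 : 0 <= l1_norm haar f by apply: Rintegral_ge0.
(* The bound by [t] controls the growth of the volume; the other one makes the shell, weighted by
   the L1 norm, cost at most [eps * V]. *)
pose eta := Num.min t (eps / (l1_norm haar f + 1)).
have eta0 : 0 < eta by rewrite lt_min t0/= divr_gt0// ltr_wpDl.
have etaM : eta * l1_norm haar f <= eps.
  apply: (@le_trans _ _ (eps / (l1_norm haar f + 1) * l1_norm haar f)).
    by rewrite ler_wpM2r// ge_min lexx orbT.
  rewrite -mulrA ler_piMr ?(ltW eps0)// mulrC ler_pdivrMr; last by rewrite ltr_wpDl.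
  by rewrite mul1r lerDl.
have [r0 r00 r0P] := ball_vol_ratio (D + 1 + L) eta0.
have key r : r0 <= r -> deep_bound haar f (r + D) L eps <=
    ball_vol n (r + D + 1 + L) * (lam + 2 * eps).
  move=> rr; have r_ge0 : 0 <= r by rewrite (le_trans _ rr)// ltW.
  rewrite /deep_bound.
  set V := ball_vol n (r + D + 1 + L); set V1 := ball_vol n (r + D + 1).
  have V1V : V1 <= V.
    by apply: ball_vol_le; [rewrite !addr_ge0|rewrite lerDl ltW].
  (* Both [V1] and [V] are at least [ball_vol n r], while [V] exceeds it by at most the fraction
     [eta]. *)
  have VV1 : V - V1 <= eta * V.
    have rV1 : ball_vol n r <= V1.
      by apply: ball_vol_le => //; rewrite -addrA lerDl addr_ge0.
    have := r0P r rr; rewrite !addrA -/V => V_le.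
    have : eta * ball_vol n r <= eta * V.
      by rewrite ler_wpM2l ?(ltW eta0)// (le_trans rV1).
    by lra.
  have V_ge0 : 0 <= V by rewrite ltW// ball_vol_gt0// ltr_wpDl// !addr_ge0.
  have h1 : V1 * (lam + eps) <= V * (lam + eps).
    by rewrite ler_wpM2r// addr_ge0 ?(ltW lam0) ?(ltW eps0).
  have h2 : (V - V1) * l1_norm haar f <= V * eps.
    apply: (@le_trans _ _ (eta * V * l1_norm haar f)); first by rewrite ler_wpM2r.
    by rewrite mulrAC mulrC ler_wpM2l.
  by lra.
have eps4 : 4 * eps = lam * t by rewrite /eps; field.
have epslam : 4 * eps < lam by rewrite eps4 gtr_pMr.
exists r0 => // r rr.
have r_gt0 : 0 < r by rewrite (lt_le_trans _ rr).
have rD0 : 0 < r + D by rewrite ltr_wpDr.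
have f10 : 0 <= f1.
  by apply: (mot_one_ge0 L0 tL epslam); exists (r + D) => //; exact: key.
split => // p N z zr zs.
have := count_bound rD0 L0 tL (ltW epslam) (key r rr) zr zs.
rewrite eps4 (_ : lam - lam * t = lam * (1 - t)); last by ring.
move=> /le_trans; apply; apply: ler_wpM2l => //.
have := r0P r rr; rewrite !addrA => /le_trans; apply.
apply: ler_wpM2r; first by rewrite ltW// ball_vol_gt0.
by rewrite lerD2l ge_min lexx.
Qed.

End count.

(** * Packings *)

Section bodies.
Variables (R : realType) (n : nat).
Local Notation vol := (lebesgue_cv R n).
Implicit Types K P : set 'cV[R]_n.

Lemma compact_cube K : compact K -> exists2 s : R, 0 <= s & K `<=` cube s.
Proof.
move=> /compact_bounded[M [_ KM]]; exists (`|M| + 1); first by rewrite addr_ge0.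
move=> x Kx i; apply: (@le_trans _ _ `|x|).
  rewrite [leRHS]/Num.Def.normr/= mx_normrE.
  exact: (le_bigmax _ (fun ij => `|x ij.1 ij.2|) (i, ord0)).
by apply: KM Kx; rewrite ltr_pwDr// ler_norm.
Qed.

Lemma measurable_compact K : compact K -> measurable K.
Proof.
move=> cK; rewrite -(setCK K); apply: measurableC; apply: measurable_mx_open.
apply: closed_openC; exact: compact_closed (@norm_hausdorff R 'cV[R]_n) cK.
Qed.

Lemma compact_vol_lty K : compact K -> (vol K < +oo)%E.
Proof.
move=> cK; have [s s0 Ks] := compact_cube cK.
apply: (@le_lt_trans _ _ (vol (cube s))).
  by apply: le_measure; rewrite ?inE//; [exact: measurable_compact|exact: measurable_cube].
by rewrite lebesgue_cv_cube// ltry.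
Qed.

Lemma measurable_mot_image z K : measurable K -> measurable (mot_image z K).
Proof.
move=> mK; rewrite mot_image_preimage.
exact: preimage_measurable (preserves_lebesgue_cv_mot (mot_inv z)).1 mK.
Qed.

Lemma vol_mot_image z K : measurable K -> vol (mot_image z K) = vol K.
Proof.
by move=> mK; rewrite mot_image_preimage (preserves_lebesgue_cv_mot (mot_inv z)).2.
Qed.

(** A packing controls interiors of copies, condition (ii) speaks of copies of the interior; this
    inclusion transfers disjointness from the former to the latter. *)
Lemma interior_mot_image z K : mot_image z K° `<=` (mot_image z K)°.
Proof.
have oz : open (mot_image z K°).
  rewrite mot_image_preimage; apply: open_comp; last exact: open_interior.
  have cst m q (C : 'M[R]_(m, q)) : continuous (fun _ : 'cV[R]_n => C).
    exact: cst_continuous.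
  have cid : continuous (fun x : 'cV[R]_n => x) by move=> x; exact: cvg_id.
  by move=> x _; exact: (continuous_addmx (cst _ _ _) (continuous_mulmx (cst _ _ _) cid)).
rewrite -open_subsetE//; apply: image_subset; exact: interior_subset.
Qed.

(** Applying the inverse of [w] brings the pair to the normal form of condition (ii), with the
    relative motion [w^-1 z]. *)
Lemma packing_interiorI K z w :
  mot_image z K° `&` mot_image w K° = set0 ->
  K° `&` mot_image (mot_mul (mot_inv w) z) K° = set0.
Proof.
move=> zw; apply/seteqP; split => // x [Kx]; rewrite -mot_image_mul => -[y zy yx].
have : (mot_image z K° `&` mot_image w K°) (w.1 + w.2 *m x); last by rewrite zw.
split; last by exists x.
suff -> : w.1 + w.2 *m x = y by [].
by rewrite -yx /= mulmxDr mulmxN !mulmxA so_invmx so_trmxKr !mul1mx addNKr.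
Qed.

(** The origin need not lie in [K], so [z.1] may be outside the copy; it is within [D] of each of
    its points because rotations preserve [enorm]. *)
Lemma near_center K (D r : R) (p : 'cV[R]_n) z :
  (forall x, K x -> enorm x <= D) ->
  mot_image z K `&` euclidean_ball p r !=set0 -> enorm (z.1 - p) <= r + D.
Proof.
move=> KD [_ [[x Kx <-]]]; rewrite euclidean_ballE/= => xr.
have -> : z.1 - p = (z.1 + z.2 *m x - p) + - (z.2 *m x) by rewrite addrAC addrK.
by rewrite (le_trans (enormD _ _))// lerD// enormN enorm_SO KD.
Qed.

End bodies.

(** * From the count of copies to the upper density *)

Section density.
Variables (R : realType) (n : nat) (haar : probability (SO R n) R).
Hypothesis haarP : is_haar haar.
Local Notation mu := (mot_sf haar).
Local Notation vol := (lebesgue_cv R n).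
Variable K : set 'cV[R]_n.
Hypothesis Kbody : convex_body K.
Variable f : motion R n -> R.
Hypothesis f_L1 : mu.-integrable setT (EFin \o f).
Hypothesis f_bounded : exists M : R, forall z, `|f z| <= M.
Hypothesis f_continuous : continuous f.
Hypothesis f_pt : positive_type haar (fun z => (f z)%:C%C).
Hypothesis f_le0 : forall z, K° `&` mot_image z K° = set0 -> f z <= 0.
Local Notation lam := (mass haar f).
Local Notation f1 := (f (mot_one R n)).
Hypothesis lam_gt0 : 0 < lam.
Variable P : set 'cV[R]_n.
Hypothesis Ppacking : packing K P.

(** The count applies to every finite subfamily of the copies that meet the ball, so it also shows
    that they are finite in number; subadditivity of volume then concludes. *)
Lemma packing_count (p : 'cV[R]_n) (r b D : R) : 0 <= b ->
  (forall x, K x -> enorm x <= D) ->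
  (forall N (z : 'I_N -> motion R n), (forall i, enorm ((z i).1 - p) <= r + D) ->
     separated f z -> N%:R <= b) ->
  (vol (euclidean_ball p r `&` P) <= b%:E * vol K)%E.
Proof.
move=> b0 KD count; have [cK _ _] := Kbody.
have mK := measurable_compact cK.
have [Cs [CsK Csdisj ->]] := Ppacking.
pose hit := [set C | Cs C /\ C `&` euclidean_ball p r !=set0].
have hitP (s : seq (set 'cV[R]_n)) : uniq s -> (forall C, C \in s -> hit C) ->
    (size s)%:R <= b.
  move=> us hs.
  have hsi (i : 'I_(size s)) : hit (nth set0 s i) by apply: hs; exact: mem_nth.
  (* A symmetric body can yield the same copy from several motions. The packing is a set of copies,
     so one motion is chosen for each. *)
  have /choice[z zP] (i : 'I_(size s)) : exists z, nth set0 s i = mot_image z K.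
    by have [/CsK] := hsi i.
  apply: (count _ z) => [i|i j ij].
    by apply: near_center KD _; rewrite -zP; have [] := hsi i.
  apply: f_le0; apply: packing_interiorI; apply/seteqP; split => // x [zi zj].
  have : ((nth set0 s i)° `&` (nth set0 s j)°) x.
    by rewrite !zP; split; exact: interior_mot_image.
  rewrite Csdisj//; [by have [] := hsi i|by have [] := hsi j|].
  move/eqP; rewrite nth_uniq//; exact/negP.
(* An infinite family would contain a finite one with more than [b] members. *)
have /finite_fsetP[X hitX] : finite_set hit.
  apply: contrapT => /(infinite_set_fset (Num.Def.truncn b).+1)[X Xhit].
  apply/negP; rewrite -ltnNge ltnS.
  have Xb : (size (finmap.enum_fset X))%:R <= b.
    by apply: hitP; [exact: finmap.fset_uniq|move=> C CX; exact: Xhit].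
  by rewrite truncn_ge_nat.
set s := finmap.enum_fset X.
have sE C : (C \in s) <-> hit C by rewrite hitX.
have sb : (size s)%:R <= b.
  by apply: hitP; [exact: finmap.fset_uniq|move=> C /sE].
have volC k : (k < size s)%N -> measurable (nth set0 s k) /\ vol (nth set0 s k) = vol K.
  move=> ks; have /sE[/CsK[z ->] _] := mem_nth set0 ks.
  by split; [exact: measurable_mot_image|exact: vol_mot_image].
(* Inside the ball the possibly infinite union becomes a finite one, hence measurable. *)
have PE : euclidean_ball p r `&` \bigcup_(C in Cs) C =
    euclidean_ball p r `&` \big[setU/set0]_(k < size s) nth set0 s k.
  apply/seteqP; split => x [xB].
    move=> [C CsC Cx]; split => //.
    have /sE Cs' : hit C by split => //; exists x.
    rewrite -bigcup_mkord; exists (index C s); first by rewrite /= index_mem.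
    by rewrite nth_index.
  rewrite -bigcup_mkord => -[k /= ks kx]; split=> //.
  by exists (nth set0 s k) => //; have /sE[] := mem_nth set0 ks.
rewrite PE.
apply: (@le_trans _ _ (\sum_(k < size s) vol (nth set0 s k))%E).
  apply: content_subadditive.
  - by move=> k /= /volC[].
  - apply: measurableI; first exact: measurable_euclidean_ball.
    by apply: bigsetU_measurable => k _; have [] := volC k (ltn_ord k).
  - exact: subIsetr.
rewrite (eq_bigr (fun=> vol K)); last by move=> k _; have [] := volC k (ltn_ord k).
have volKE : vol K = (fine (vol K))%:E.
  by rewrite fineK// ge0_fin_numE//; exact: compact_vol_lty.
rewrite volKE sumEFin -EFinM lee_fin sumr_const card_ord -mulr_natl.
by rewrite ler_wpM2r// fine_ge0.
Qed.

Lemma upper_density_le_eps (t : R) : 0 < t <= 2^-1 ->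
  (upper_density P <= (f1 / lam * fine (vol K) * (1 + 4 * t))%:E)%E.
Proof.
move=> /andP[t0 t2]; have [cK _ _] := Kbody.
have [s s0 Ks] := compact_cube cK.
pose D := n%:R * s.
have D0 : 0 <= D by rewrite mulr_ge0.
have KD x : K x -> enorm x <= D by move=> /Ks; exact: enorm_cube.
have t1 : t < 1 by rewrite (le_lt_trans t2)// invf_lt1// ltr1n.
have t01 : 0 < t < 1 by rewrite t0.
have [r0 r00 r0P] := eventual_count_bound haarP f_L1 f_bounded f_continuous f_pt
  lam_gt0 D0 t01.
(* The upper limit is an infimum over neighbourhoods of [+oo]; the half-line from [r0] is one of
   them. *)
apply: ge_ereal_inf.
exists (ereal_sup ((fun r : R => ereal_sup
    [set (vol (euclidean_ball p r `&` P) / vol (euclidean_ball p r))%E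
    | p in [set: 'cV[R]_n]]) @` [set r | r0 <= r])).
  by exists [set r | r0 <= r] => //; exact: nbhs_pinfty_ge (num_real r0).
apply: ge_ereal_sup => _ [r /= rr0 <-]; apply: ge_ereal_sup => _ [p _ <-].
have r_gt0 : 0 < r by rewrite (lt_le_trans _ rr0).
have V0 : 0 < ball_vol n r by exact: ball_vol_gt0.
have [f10 count] := r0P r rr0.
have lt0 : 0 < lam * (1 - t) by rewrite mulr_gt0// subr_gt0.
pose b := f1 * ((1 + t) * ball_vol n r) / (lam * (1 - t)).
have b0 : 0 <= b.
  by rewrite divr_ge0 ?(ltW lt0)// mulr_ge0// mulr_ge0 ?(ltW V0)// addr_ge0// ltW.
have count_b N (z : 'I_N -> motion R n) :
    (forall i, enorm ((z i).1 - p) <= r + D) -> separated f z -> N%:R <= b.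
  by move=> zr zs; rewrite ler_pdivlMr//; exact: count zr zs.
have volKE : vol K = (fine (vol K))%:E.
  by rewrite fineK// ge0_fin_numE//; exact: compact_vol_lty.
have := packing_count b0 KD count_b.
rewrite (vol_euclidean_ball p r_gt0) -/(ball_vol n r) inver gt_eqF// volKE -EFinM => H.
have Vinv : (0 <= ((ball_vol n r)^-1)%:E :> \bar R)%E by rewrite lee_fin invr_ge0 ltW.
apply: (le_trans (lee_wpmul2r Vinv H)).
rewrite -EFinM lee_fin /b.
set k := fine (vol K); have k0 : 0 <= k by exact: fine_ge0.
have -> : f1 * ((1 + t) * ball_vol n r) / (lam * (1 - t)) * k / ball_vol n r =
    f1 / lam * k * ((1 + t) / (1 - t)).
  by field; rewrite !gt_eqF// subr_gt0.
apply: ler_wpM2l; first by rewrite mulr_ge0// divr_ge0// ltW.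
rewrite ler_pdivrMr ?subr_gt0//.
(* After clearing the denominator, [(1 + t) / (1 - t) <= 1 + 4 * t] is twice this inequality; it is
   where [t <= 2^-1] matters. *)
have : 0 <= t * (1 - 2 * t).
  by rewrite mulr_ge0 ?(ltW t0)// subr_ge0 -ler_pdivlMl// mulr1.
by lra.
Qed.

End density.

Theorem theorem1p1 (R : realType) (n : nat)
  (haar : probability (SO R n) R) (haarP : is_haar haar)
  (K : set 'cV[R]_n) (Kbody : convex_body K)
  (f : motion R n -> R)
  (f_L1 : (mot_measure haar).-integrable setT (fun z => (f z)%:E))
  (f_bounded : exists M : R, forall z, `|f z| <= M)
  (f_continuous : continuous f)
  (f_positive_type : positive_type haar (fun z => (f z)%:C%C))
  (f_le0 : forall z : motion R n,
     K° `&` mot_image z K° = set0 -> f z <= 0)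
  (lambda : R)
  (lambdaE : lambda = \int[mot_measure haar]_z f z)
  (lambda_gt0 : 0 < lambda)
  (P : set 'cV[R]_n) (Ppacking : packing K P) :
  (upper_density P <= (f (mot_one R n) / lambda)%:E * lebesgue_cv R n K)%E.
Proof.
have iL1 : (mot_sf haar).-integrable setT (EFin \o f) := f_L1.
have lamE : lambda = mass haar f := lambdaE.
rewrite lamE in lambda_gt0 *.
have [cK _ _] := Kbody.
have -> : lebesgue_cv R n K = (fine (lebesgue_cv R n K))%:E.
  by rewrite fineK// ge0_fin_numE//; exact: compact_vol_lty.
rewrite -EFinM.
set k := fine (lebesgue_cv R n K); set c := _ / _ * k.
have le_eps t : 0 < t <= 2^-1 -> (upper_density P <= (c * (1 + 4 * t))%:E)%E.
  exact: (upper_density_le_eps haarP Kbody iL1 f_bounded f_continuous f_positive_type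
    f_le0 lambda_gt0 Ppacking).
apply/lee_addgt0Pr => e e0.
(* The first bound makes [le_eps] applicable, the second gives [c * (4 * t) <= e]; adding 1 to the
   absolute value of [c] avoids a division by 0. *)
pose t := Num.min 2^-1 (e / (4 * (`|c| + 1))).
have c0 : 0 < `|c| + 1 by rewrite ltr_wpDl.
have t0 : 0 < t by rewrite lt_min invr_gt0 ltr0n/= divr_gt0// mulr_gt0.
apply: (le_trans (le_eps t _)); first by rewrite t0 ge_min lexx.
rewrite -EFinD lee_fin mulrDr mulr1 lerD2l.
have : c * (4 * t) <= (`|c| + 1) * (4 * t).
  by rewrite ler_wpM2r ?mulr_ge0 ?(ltW t0)// (le_trans (ler_norm _))// lerDl.
move=> /le_trans; apply.
have : t <= e / (4 * (`|c| + 1)) by rewrite ge_min lexx orbT.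
rewrite ler_pdivlMr ?mulr_gt0//; move: (`|c| + 1) => a.
by rewrite (_ : t * (4 * a) = a * (4 * t))//; ring.
Qed.
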